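(* Let $(H,G,\mu)$ be a crossed module. For each $n\ge0$, the homology group $H_n(H,G,\mu)$ with integral coefficients (defined as the homology of the total complex of the bar bicomplex of the nerve) is isomorphic to the $n$th integral homology of the crossed module $(H,G,\mu)$ in the sense of Baues and Ellis, i.e. the $n$th integral homology of the classifying space of $(H,G,\mu)$.
   Context: A crossed module $(H,G,\mu)$ is a group homomorphism $\mu\colon H\to G$ with an action of $G$ on $H$ by automorphisms such that $\mu({}^gh)=g\mu(h)g^{-1}$ and ${}^{\mu(h)}h'=hh'h^{-1}$. Nerve: $\mathrm{Ner}_*(H,G,\mu)$ is the simplicial group with $\mathrm{Ner}_n=H\rtimes(\cdots(H\rtimes G)\cdots)$ ($n$ copies of $H$, the outermost $H$ being acted on by $(h_2,\dots,h_n,g)\in \mathrm{Ner}_{n-1}$ through $\mu(h_2\cdots h_n)g\in G$), faces $d_0(h_1,\dots,h_n,g)=(h_2,\dots,h_n,g)$, $d_i(h_1,\dots,h_n,g)=(h_1,\dots,h_ih_{i+1},\dots,h_n,g)$ for $0<i<n$, $d_n(h_1,\dots,h_n,g)=(h_1,\dots,h_{n-1},\mu(h_n)g)$, and degeneracies $s_i$ inserting $1$ after $h_i$. Integral homology of this paper: for a group $G$, $B_*(G)$ is the bar resolution, $B_m(G)=\mathbb{Z}(G)^{\otimes(m+1)}$, $m\ge0$. $H_n(H,G,\mu)$ is the $n$th homology of the total complex of the bicomplex with entries $B_m(\mathrm{Ner}_n(H,G,\mu))\otimes_{\mathrm{Ner}_n(H,G,\mu)}\mathbb{Z}$ (trivial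 action on $\mathbb Z$), with vertical differential that of the bar resolution and horizontal differential the alternating sum of the maps induced by the faces of the nerve. Baues--Ellis homology: let $\mathcal{N}_{**}(H,G,\mu)$ be the bisimplicial set obtained by taking, in each dimension of the simplicial group $\mathrm{Ner}_*(H,G,\mu)$, the nerve of the group regarded as a one-object category. The classifying space of $(H,G,\mu)$ is the geometric realisation of the diagonal of $\mathcal{N}_{**}(H,G,\mu)$, and the Baues--Ellis integral homology of $(H,G,\mu)$ is its integral homology; equivalently, the homology of the diagonal of the bisimplicial abelian group $\mathbb{Z}(\mathcal{N}_{**}(H,G,\mu))$ obtained by applying the free abelian group functor in each bidegree. *)

(* Defs.v *)
From HB Require Import structures.
From mathcomp Require Import boolp freeg.
From mathcomp Require Import all_boot all_algebra.
From mathcomp Require Import zify.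

Set Implicit Arguments.
Unset Strict Implicit.
Unset Printing Implicit Defensive.

Import GRing.Theory.
Local Open Scope ring_scope.
Local Open Scope quotient_scope.

Section FreeExtension.
Variables (K : choiceType) (V : zmodType) (f : K -> V).

Definition fgext (D : {freeg K / int}) : V := fglift (f : K -> zmodule V) D.

Lemma fgext_is_zmod_morphism : zmod_morphism fgext.
Proof. exact: (@lift_is_additive int K (zmodule V) f). Qed.

HB.instance Definition _ :=
  GRing.isZmodMorphism.Build {freeg K / int} V fgext fgext_is_zmod_morphism.

Lemma fgextU x : fgext << x >> = f x.
Proof. by rewrite /fgext liftU scale1r. Qed.

End FreeExtension.

Lemma fg_eq_additive (K : choiceType) (V : zmodType)
    (f g : {additive {freeg K / int} -> V}) :
  (forall x : K, f << x >> = g << x >>) -> f =1 g.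
Proof.
move=> fg; elim/freeg_ind_dom0 => [|k x D _ _ IH]; first by rewrite !raddf0.
rewrite !raddfD IH; congr (_ + _).
have -> : (<< k *g x >> : {freeg K / int}) = << x >> *~ k.
  by rewrite freegU_mulz intz.
by rewrite !raddfMz fg.
Qed.

Definition fgpush (K L : choiceType) (f : K -> L) :
    {additive {freeg K / int} -> {freeg L / int}} :=
  fgext (fun x => << f x >>).

Lemma fgpushU (K L : choiceType) (f : K -> L) x :
  fgpush f << x >> = << f x >>.
Proof. exact: fgextU. Qed.

Section AlternatingSum.
Variables (V W : zmodType) (n : nat) (F : nat -> {additive V -> W}).

Definition altsum (x : V) : W := \sum_(i < n) F i x *~ (-1) ^+ i.

Lemma altsum_is_zmod_morphism : zmod_morphism altsum.
Proof.
move=> x y; rewrite /altsum -sumrB; apply: eq_bigr => i _.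
by rewrite raddfB mulrzBl.
Qed.

HB.instance Definition _ :=
  GRing.isZmodMorphism.Build V W altsum altsum_is_zmod_morphism.

End AlternatingSum.

Lemma altsum_altsum_eq0 (U V W : zmodType) (n : nat)
    (F : nat -> {additive U -> V}) (E : nat -> {additive V -> W}) :
  (forall i j x, (i <= j < n)%N -> E i (F j.+1 x) = E j (F i x)) ->
  forall x, altsum n E (altsum n.+1 F x) = 0.
Proof.
move=> EF x; rewrite /altsum.
under eq_bigr => i _ do rewrite raddf_sum mulrz_suml.
rewrite pair_big /=.
under eq_bigr => p _ do rewrite raddfMz -mulrzA -exprD.
rewrite (bigID (fun p : 'I_n * 'I_n.+1 => (p.1 < p.2)%N)) /=.
apply/eqP; rewrite addr_eq0 -sumrN; apply/eqP.
case: n F E EF => [|n] F E EF; first by rewrite !big1 // => -[[]].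
pose h (p : 'I_n.+1 * 'I_n.+2) : 'I_n.+1 * 'I_n.+2 := (inord p.2.-1, inord p.1).
pose h' (p : 'I_n.+1 * 'I_n.+2) : 'I_n.+1 * 'I_n.+2 := (inord p.2, inord p.1.+1).
rewrite (reindex_onto h' h) /=; last first.
  move=> [i j] /= ij; have ? := ltn_ord i; have ? := ltn_ord j.
  congr pair; apply: val_inj; rewrite /= !inordK //; lia.
have P (p : 'I_n.+1 * 'I_n.+2) :
  ((h' p).1 < (h' p).2)%N && (h (h' p) == p) = ~~ (p.1 < p.2)%N.
  case: p => i j; rewrite /h /h' /= -leqNgt.
  have ? := ltn_ord i; have ? := ltn_ord j.
  have i1 : (i.+1 < n.+2)%N by lia.
  rewrite (inordK i1).
  have [ji|ij] := leqP j i; last first.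
    apply/negP => /andP[mi /eqP[_ /(congr1 val)]] /=; move: mi.
    case: (inord j : 'I_n.+1) => m mn /= mi; rewrite inordK; lia.
  rewrite !inordK; [|lia..].
  apply/andP; split; first lia.
  apply/eqP; congr pair; apply: val_inj; rewrite /= !inordK //; lia.
rewrite (eq_bigl _ _ P); apply: eq_bigr => -[i j] /=.
rewrite -leqNgt => ji; have ? := ltn_ord i; have ? := ltn_ord j.
rewrite !inordK; [|lia..]; rewrite EF; last by lia.
by rewrite addSn exprS mulN1r mulrNz addnC.
Qed.

Record chainComplex := ChainComplex {
  ccobj :> nat -> zmodType;
  ccdiff : forall n, {additive ccobj n.+1 -> ccobj n};
  ccdiffK : forall n (x : ccobj n.+2), ccdiff n (ccdiff n.+1 x) = 0
}.

Section Homology.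
Variables (C : chainComplex) (n : nat).

Definition iscycle : {pred C n} :=
  match n return C n -> bool with
  | 0 => fun _ => true
  | m.+1 => fun x => ccdiff C m x == 0
  end.

Lemma iscycle_zmod_closed : zmod_closed iscycle.
Proof.
rewrite /iscycle; case: n => [|m]; split=> //.
  by rewrite unfold_in raddf0.
move=> x y; rewrite !unfold_in raddfB => /eqP -> /eqP ->.
by rewrite subr0.
Qed.

HB.instance Definition _ :=
  GRing.isZmodClosed.Build (C n) iscycle iscycle_zmod_closed.

Record cycles := Cycle { cycle_val : C n; _ : cycle_val \in iscycle }.

HB.instance Definition _ := [isSub for cycle_val].
HB.instance Definition _ := [Choice of cycles by <:].
HB.instance Definition _ := [SubChoice_isSubZmodule of cycles by <:].

Definition isboundary : {pred cycles} :=
  fun z => `[< exists y : C n.+1, ccdiff C n y = val z >].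

Lemma isboundary_zmod_closed : zmod_closed isboundary.
Proof.
split=> [|x y]; rewrite !unfold_in.
  by apply/asboolP; exists 0; rewrite !raddf0.
move=> /asboolP[a ea] /asboolP[b eb]; apply/asboolP; exists (a - b).
by rewrite !raddfB ea eb.
Qed.

HB.instance Definition _ :=
  GRing.isZmodClosed.Build cycles isboundary isboundary_zmod_closed.

Definition homology : zmodType := Quotient.quot isboundary.

End Homology.

(* First index horizontal, second index vertical; the squares commute, and the
   sign making the total differential square to zero is put in [totdiff]. *)
Record bicomplex := Bicomplex {
  bcobj :> nat -> nat -> zmodType;
  bch : forall p q, {additive bcobj p.+1 q -> bcobj p q};
  bcv : forall p q, {additive bcobj p q.+1 -> bcobj p q};
  bchK : forall p q (x : bcobj p.+2 q), bch p q (bch p.+1 q x) = 0;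
  bcvK : forall p q (x : bcobj p q.+2), bcv p q (bcv p q.+1 x) = 0;
  bchv : forall p q (x : bcobj p.+1 q.+1),
    bch p q (bcv p.+1 q x) = bcv p q (bch p q.+1 x)
}.

Section Families.
Variable C : nat -> nat -> zmodType.

Definition family2 := forall p q, C p q.
HB.instance Definition _ := Choice.copy family2 (forall p q, C p q).

Implicit Types x y z : family2.

Definition family2_zero : family2 := fun _ _ => 0.
Definition family2_opp x : family2 := fun p q => - x p q.
Definition family2_add x y : family2 := fun p q => x p q + y p q.

Lemma family2P x y : (forall p q, x p q = y p q) -> x = y.
Proof.
by move=> xy; apply: functional_extensionality_dep => p;
   apply: functional_extensionality_dep.
Qed.

Lemma family2_addA : associative family2_add.
Proof. by move=> x y z; apply: family2P => p q; apply: addrA. Qed.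
Lemma family2_addC : commutative family2_add.
Proof. by move=> x y; apply: family2P => p q; apply: addrC. Qed.
Lemma family2_add0 : left_id family2_zero family2_add.
Proof. by move=> x; apply: family2P => p q; apply: add0r. Qed.
Lemma family2_addN : left_inverse family2_zero family2_opp family2_add.
Proof. by move=> x; apply: family2P => p q; apply: addNr. Qed.

HB.instance Definition _ := GRing.isZmodule.Build family2
  family2_addA family2_addC family2_add0 family2_addN.

End Families.

Section Total.
Variable C : bicomplex.

(* The direct sum of the [C p q] with [p + q = n], as the families [x p q]
   vanishing off that antidiagonal. *)
Definition antidiag (n : nat) : {pred family2 C} :=
  fun x => `[< forall p q, (p + q)%N <> n -> x p q = 0 >].

Lemma antidiag_zmod_closed n : zmod_closed (antidiag n).
Proof.
split=> [|x y]; rewrite !unfold_in; first exact/asboolP.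
move=> /asboolP x0 /asboolP y0; apply/asboolP => p q pq.
have -> : (x - y) p q = x p q - y p q by [].
by rewrite x0 // y0 // subr0.
Qed.

HB.instance Definition _ n := GRing.isZmodClosed.Build (family2 C)
  (antidiag n) (antidiag_zmod_closed n).

Record totobj (n : nat) :=
  TotObj { totval : family2 C; _ : totval \in antidiag n }.

HB.instance Definition _ n := [isSub for @totval n].
HB.instance Definition _ n := [Choice of totobj n by <:].
HB.instance Definition _ n := [SubChoice_isSubZmodule of totobj n by <:].

Definition totdiff_fam (x : family2 C) : family2 C :=
  fun p q => bch C p q (x p.+1 q) + bcv C p q (x p q.+1) *~ (-1) ^+ p.

Lemma totdiff_subproof n (x : totobj n.+1) :
  totdiff_fam (val x) \in antidiag n.
Proof.
rewrite unfold_in; apply/asboolP => p q pq; rewrite /totdiff_fam.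
have /asboolP x0 := valP x.
by rewrite !x0 ?raddf0 ?mul0rz ?addr0 ?add0r //; lia.
Qed.

Definition totdiff n (x : totobj n.+1) : totobj n :=
  TotObj (totdiff_subproof x).

Lemma totdiff_is_zmod_morphism n : zmod_morphism (@totdiff n).
Proof.
move=> x y; apply: val_inj; apply: family2P => p q.
rewrite [val (totdiff x - totdiff y)]raddfB /= /totdiff_fam.
have e (a b : family2 C) i j : (a - b) i j = a i j - b i j by [].
by rewrite !e !raddfB mulrzBl opprD addrACA.
Qed.

HB.instance Definition _ n := GRing.isZmodMorphism.Build
  (totobj n.+1) (totobj n) (@totdiff n) (@totdiff_is_zmod_morphism n).

Lemma totdiffK n (x : totobj n.+2) : totdiff (totdiff x) = 0.
Proof.
apply: val_inj; apply: family2P => p q; rewrite /= /totdiff_fam /=.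
rewrite /totdiff_fam !raddfD !raddfMz bchK bcvK bchv !mul0rz add0r addr0.
by rewrite exprS mulN1r mulrNz addNr.
Qed.

Definition total : chainComplex :=
  @ChainComplex totobj (fun n => @totdiff n) totdiffK.

End Total.

(* Face and degeneracy maps are indexed by [nat]; in dimension [n] only the
   [d n i : X n.+1 -> X n] with [i <= n.+1] and the [s n i : X n -> X n.+1]
   with [i <= n] are meaningful, and the others are unconstrained. *)
Record simplicial_identities (X : nat -> Type)
    (d : forall n, nat -> X n.+1 -> X n)
    (s : forall n, nat -> X n -> X n.+1) : Prop := SimplicialIdentities {
  simp_dd : forall n i j (x : X n.+2), (i <= j <= n.+1)%N ->
    d n i (d n.+1 j.+1 x) = d n j (d n.+1 i x);
  simp_ds_lt : forall n i j (x : X n.+1), (i <= j <= n)%N ->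
    d n.+1 i (s n.+1 j.+1 x) = s n j (d n i x);
  simp_ds_eq : forall n j (x : X n), (j <= n)%N -> d n j (s n j x) = x;
  simp_ds_eqS : forall n j (x : X n), (j <= n)%N -> d n j.+1 (s n j x) = x;
  simp_ds_gt : forall n i j (x : X n.+1), (j < i <= n.+1)%N ->
    d n.+1 i.+1 (s n.+1 j x) = s n j (d n i x);
  simp_ss : forall n i j (x : X n), (i <= j <= n)%N ->
    s n.+1 i (s n j x) = s n.+1 j.+1 (s n i x)
}.

Record simplicialSet := SimplicialSet {
  ssobj :> nat -> choiceType;
  ssface : forall n, nat -> ssobj n.+1 -> ssobj n;
  ssdegen : forall n, nat -> ssobj n -> ssobj n.+1;
  ssP : simplicial_identities ssface ssdegen
}.

Record simplicialGroup := SimplicialGroup {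
  sgobj :> nat -> groupType;
  sgface : forall n, nat -> {multiplicative sgobj n.+1 -> sgobj n};
  sgdegen : forall n, nat -> {multiplicative sgobj n -> sgobj n.+1};
  sgP : simplicial_identities (fun n i => sgface n i) (fun n i => sgdegen n i)
}.

Record bisimplicialSet := BisimplicialSet {
  bsobj :> nat -> nat -> choiceType;
  bshface : forall p q, nat -> bsobj p.+1 q -> bsobj p q;
  bshdegen : forall p q, nat -> bsobj p q -> bsobj p.+1 q;
  bsvface : forall p q, nat -> bsobj p q.+1 -> bsobj p q;
  bsvdegen : forall p q, nat -> bsobj p q -> bsobj p q.+1;
  bshP : forall q, simplicial_identities
    (fun p => @bshface p q) (fun p => @bshdegen p q);
  bsvP : forall p, simplicial_identities (@bsvface p) (@bsvdegen p);
  bs_dd : forall p q i j (x : bsobj p.+1 q.+1),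
    bshface i (bsvface j x) = bsvface j (bshface i x);
  bs_ds : forall p q i j (x : bsobj p.+1 q),
    bshface i (bsvdegen j x) = bsvdegen j (bshface i x);
  bs_sd : forall p q i j (x : bsobj p q.+1),
    bshdegen i (bsvface j x) = bsvface j (bshdegen i x);
  bs_ss : forall p q i j (x : bsobj p q),
    bshdegen i (bsvdegen j x) = bsvdegen j (bshdegen i x)
}.

Section Diagonal.
Variable X : bisimplicialSet.

Definition diag_face n i (x : X n.+1 n.+1) : X n n :=
  bshface i (bsvface i x).
Definition diag_degen n i (x : X n n) : X n.+1 n.+1 :=
  bshdegen i (bsvdegen i x).

Lemma diagP : simplicial_identities (X := fun n => X n n) diag_face diag_degen.
Proof.
split=> [n i j x ij|n i j x ij|n j x ij|n j x ij|n i j x ij|n i j x ij];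
  rewrite /diag_face /diag_degen.
- by rewrite -!bs_dd (simp_dd (bshP X _)) // (simp_dd (bsvP X _)).
- rewrite -bs_ds -bs_sd.
  by rewrite (simp_ds_lt (bshP X _)) // (simp_ds_lt (bsvP X _)) // bs_dd.
- by rewrite -bs_sd (simp_ds_eq (bshP X _)) // (simp_ds_eq (bsvP X _)).
- by rewrite -bs_sd (simp_ds_eqS (bshP X _)) // (simp_ds_eqS (bsvP X _)).
- rewrite -bs_ds -bs_sd.
  by rewrite (simp_ds_gt (bshP X _)) // (simp_ds_gt (bsvP X _)) // bs_dd.
- by rewrite -!bs_ss (simp_ss (bshP X _)) // (simp_ss (bsvP X _)).
Qed.

Definition diagonal : simplicialSet := SimplicialSet diagP.

End Diagonal.

Section SimplicialChains.
Variable X : simplicialSet.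

Definition schain_diff n :
    {additive {freeg (X n.+1) / int} -> {freeg (X n) / int}} :=
  altsum n.+2 (fun i => fgpush (@ssface X n i)).

Lemma schain_diffK n (x : {freeg (X n.+2) / int}) :
  schain_diff n (schain_diff n.+1 x) = 0.
Proof.
apply: altsum_altsum_eq0 => i j {}x ij.
have E : fgpush (@ssface X n i) \o fgpush (@ssface X n.+1 j.+1)
  =1 fgpush (@ssface X n j) \o fgpush (@ssface X n.+1 i).
  by apply: fg_eq_additive => z /=; rewrite !fgpushU (simp_dd (ssP X)).
exact: (E x).
Qed.

Definition simplicial_chains : chainComplex :=
  @ChainComplex (fun n => {freeg (X n) / int}) schain_diff schain_diffK.

End SimplicialChains.

Local Open Scope group_scope.

Lemma multiplicative1 (G H : groupType) (f : {multiplicative G -> H}) :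
  f 1 = 1.
Proof. by apply: (mulgI (f 1)); rewrite -gmulfM !mulg1. Qed.

Record autAction (G H : groupType) := AutAction {
  aact :> G -> H -> H;
  aact1 : forall h, aact 1 h = h;
  aactM : forall g g' h, aact (g * g') h = aact g (aact g' h);
  aact_morph : forall g, {morph aact g : h h' / h * h'}
}.

Record crossedModule (H G : groupType) := CrossedModule {
  cm_mu : {multiplicative H -> G};
  cm_act : autAction G H;
  cm_equivariant : forall g h, cm_mu (cm_act g h) = g * cm_mu h * g^-1;
  cm_peiffer : forall h h', cm_act (cm_mu h) h' = h * h' * h^-1
}.

Section PullbackAction.
Variables (K G H : groupType) (a : autAction G H) (f : {multiplicative K -> G}).

Lemma pullback_act1 h : a (f 1) h = h.
Proof. by rewrite multiplicative1 aact1. Qed.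
Lemma pullback_actM k k' h : a (f (k * k')) h = a (f k) (a (f k') h).
Proof. by rewrite gmulfM aactM. Qed.

Definition pullback_action : autAction K H :=
  @AutAction K H (fun k => a (f k)) pullback_act1 pullback_actM
    (fun k => aact_morph a (f k)).

End PullbackAction.

Record semidirect (K H : groupType) (a : autAction K H) :=
  Semidirect { sdl : H; sdr : K }.

Section Semidirect.
Variables (K H : groupType) (a : autAction K H).
Local Notation semidirect := (semidirect a).
Local Notation Semidirect := (Semidirect a).

Definition sd_to_pair (z : semidirect) : H * K := (sdl z, sdr z).
Definition sd_of_pair (p : H * K) : semidirect := Semidirect p.1 p.2.
Lemma sd_to_pairK : cancel sd_to_pair sd_of_pair. Proof. by case. Qed.
HB.instance Definition _ := Choice.copy semidirect (can_type sd_to_pairK).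

Definition sd_one : semidirect := Semidirect 1 1.
Definition sd_mul (x y : semidirect) : semidirect :=
  Semidirect (sdl x * a (sdr x) (sdl y)) (sdr x * sdr y).
Definition sd_inv (x : semidirect) : semidirect :=
  Semidirect (a (sdr x)^-1 (sdl x)^-1) (sdr x)^-1.

Lemma aact_1 k : a k 1 = 1.
Proof. by apply: (mulgI (a k 1)); rewrite -aact_morph !mulg1. Qed.

Lemma sd_mulA : associative sd_mul.
Proof.
by move=> [h k] [h' k'] [h'' k'']; rewrite /sd_mul /= aact_morph aactM !mulgA.
Qed.
Lemma sd_mul1 : left_id sd_one sd_mul.
Proof. by move=> [h k]; rewrite /sd_mul /= aact1 !mul1g. Qed.
Lemma sd_mulr1 : right_id sd_one sd_mul.
Proof. by move=> [h k]; rewrite /sd_mul /= aact_1 !mulg1. Qed.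
Lemma sd_mulV : left_inverse sd_one sd_inv sd_mul.
Proof.
by move=> [h k]; rewrite /sd_mul /sd_inv /= -aact_morph !mulVg aact_1.
Qed.
Lemma sd_mulrV : right_inverse sd_one sd_inv sd_mul.
Proof.
move=> [h k]; rewrite /sd_mul /sd_inv /= -aactM mulgV aact1.
by rewrite !mulgV.
Qed.

HB.instance Definition _ :=
  isGroup.Build semidirect sd_mulA sd_mul1 sd_mulr1 sd_mulV sd_mulrV.

End Semidirect.

Record groupOver (G : groupType) := GroupOver {
  gosort :> groupType;
  goproj : {multiplicative gosort -> G}
}.

Section Nerve.
Variables (H G : groupType) (X : crossedModule H G).
Notation mu := (cm_mu X).
Notation act := (cm_act X).

Section Step.
Variable N : groupOver G.

Definition ner_stepgroup : groupType :=
  semidirect (pullback_action act (goproj N)).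

Definition ner_stepproj (z : ner_stepgroup) : G :=
  mu (sdl z) * goproj N (sdr z).

Lemma ner_stepproj_morph : {morph ner_stepproj : x y / x * y}.
Proof.
move=> [h k] [h' k']; rewrite /ner_stepproj /= !gmulfM cm_equivariant.
by rewrite !mulgA mulgVK.
Qed.

HB.instance Definition _ :=
  isMultiplicative.Build ner_stepgroup G ner_stepproj ner_stepproj_morph.

Definition ner_step : groupOver G := @GroupOver G ner_stepgroup ner_stepproj.

End Step.

Lemma idfun_morph (K : groupType) : {morph (@idfun K) : x y / x * y}.
Proof. by []. Qed.
HB.instance Definition _ (K : groupType) :=
  isMultiplicative.Build K K idfun (@idfun_morph K).

(* [ner n] is H >< (... (H >< G)), together with the homomorphism
   (h_1, ..., h_n, g) |-> mu (h_1 ... h_n) g to G through which it acts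
   on the next copy of H. *)
Fixpoint ner (n : nat) : groupOver G :=
  if n is m.+1 then ner_step (ner m) else @GroupOver G G idfun.

Fixpoint ner_face (n i : nat) : ner n.+1 -> ner n :=
  match n return ner n.+1 -> ner n with
  | 0 => fun z : semidirect _ =>
      if i is 0 then sdr z else mu (sdl z) * sdr z
  | m.+1 => fun z : semidirect _ =>
      match i with
      | 0 => sdr z
      | 1 => let y : semidirect _ := sdr z in
             Semidirect _ (sdl z * sdl y) (sdr y)
      | j.+1 => Semidirect _ (sdl z) (@ner_face m j (sdr z))
      end
  end.

Fixpoint ner_degen (n i : nat) {struct i} : ner n -> ner n.+1 :=
  match i with
  | 0 => fun z => Semidirect _ 1 z
  | j.+1 =>
    match n return ner n -> ner n.+1 with
    | 0 => fun z => Semidirect _ 1 z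
    | m.+1 => fun z : semidirect _ =>
        Semidirect _ (sdl z) (@ner_degen m j (sdr z))
    end
  end.

Lemma goproj_ner_face n i (z : ner n.+1) :
  goproj (ner n) (ner_face i.+1 z) = goproj (ner n.+1) z.
Proof.
elim: n i z => [|n IH] [|i] [h z] //=.
  by case: z => h' z; rewrite /ner_stepproj /= gmulfM !mulgA.
by rewrite /ner_stepproj /= IH.
Qed.

Lemma goproj_ner_degen n i (z : ner n) :
  goproj (ner n.+1) (ner_degen i z) = goproj (ner n) z.
Proof.
have mu1 : mu 1 = 1 by apply: multiplicative1.
elim: n i z => [|n IH] [|i] z //=; rewrite ?/ner_stepproj /= ?mu1 ?mul1g //.
by rewrite IH.
Qed.

Lemma ner_face_morph n i : {morph @ner_face n i : x y / x * y}.
Proof.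
elim: n i => [|n IH] [|i] // [h z] [h' z'].
  by rewrite /= gmulfM cm_equivariant !mulgA mulgVK.
case: i => [|i].
  case: z z' => [k z] [k' z'] /=; congr Semidirect.
  rewrite /= /ner_stepproj /= !mulgA aactM cm_peiffer aact_morph.
  by rewrite !mulgA mulgVK.
rewrite /= IH; congr Semidirect.
by rewrite /= goproj_ner_face.
Qed.

HB.instance Definition _ n i := isMultiplicative.Build
  (ner n.+1) (ner n) (@ner_face n i) (@ner_face_morph n i).

Lemma ner_degen_morph n i : {morph @ner_degen n i : x y / x * y}.
Proof.
have D m (x y : ner m) : Semidirect (pullback_action act (goproj (ner m))) 1 (x * y)
    = Semidirect (pullback_action act (goproj (ner m))) 1 x * 
      Semidirect (pullback_action act (goproj (ner m))) 1 y.
  by congr Semidirect; rewrite /= aact_1 mulg1.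
elim: n i => [|n IH] [|i]; try exact: D.
move=> [h z] [h' z'] /=; rewrite IH; congr Semidirect.
by rewrite /= goproj_ner_degen.
Qed.

HB.instance Definition _ n i := isMultiplicative.Build
  (ner n) (ner n.+1) (@ner_degen n i) (@ner_degen_morph n i).

Lemma nerP : simplicial_identities (X := ner) ner_face ner_degen.
Proof.
split.
- elim=> [|n IH] [|i] [|j] // [h z] /andP[ij jn] //.
    by case: z => h' z; case: i j ij jn => [|i] [|j] //= _ _; rewrite gmulfM mulgA.
  case: i j ij jn => [|i] [|j] // ij jn.
  + by case: z => h' [h'' z] /=; rewrite mulgA.
  have /= E := IH i.+1 j.+1 z; rewrite /= E //; lia.
- elim=> [|n IH] [|i] [|j] // [h z] /andP[ij jn] //.
  case: i ij => [|i] ij; first by case: z.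
  have /= E := IH i.+1 j z; rewrite /= E //; lia.
- elim=> [|n IH] [|j] z jn //; case: z => h z.
  case: j jn => [|j] jn; first by rewrite /= mulg1.
  have /= E := IH j.+1 z; rewrite /= E //; lia.
- elim=> [|n IH] [|j] z jn //=.
  + by rewrite multiplicative1 mul1g.
  + by case: z => h z; rewrite mul1g.
  + by case: z => h z; rewrite /= IH.
- elim=> [|n IH] [|i] [|j] [h z] /andP[ji iN] //=; first by case: i ji iN.
  case: i ji iN => [|i] ji iN //.
  have /= -> // := IH i.+1 j z; lia.
- elim=> [|n IH] [|i] [|j] z /andP[ij jn] //=.
  have /= -> // := IH i j (sdr z); lia.
Qed.

Definition nerve_sgroup : simplicialGroup :=
  @SimplicialGroup ner (fun n i => @ner_face n i) (fun n i => @ner_degen n i)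
    nerP.

End Nerve.

Section GroupNerve.
Variable G : groupType.

Definition gface q (i : nat) (x : {ffun 'I_q.+1 -> G}) : {ffun 'I_q -> G} :=
  [ffun j : 'I_q =>
     let a := x (widen_ord (leqnSn q) j) in
     let b := x (lift ord0 j) in
     if (j.+1 < i)%N then a else if j.+1 == i then a * b else b].

Definition gdegen q (i : nat) (x : {ffun 'I_q -> G}) : {ffun 'I_q.+1 -> G} :=
  [ffun j : 'I_q.+1 => if unlift (inord i) j is Some k then x k else 1 : G].

Let at_ q (x : {ffun 'I_q -> G}) (k : nat) : G :=
  if insub k is Some j then x j else 1.

Let at_ord q (x : {ffun 'I_q -> G}) (j : 'I_q) : x j = at_ x j.
Proof. by rewrite /at_ valK. Qed.

Let at_inj q (x y : {ffun 'I_q -> G}) :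
  (forall k, (k < q)%N -> at_ x k = at_ y k) -> x = y.
Proof. by move=> xy; apply/ffunP => j; rewrite !at_ord xy. Qed.

Let at_face q i (x : {ffun 'I_q.+1 -> G}) k : (k < q)%N ->
  at_ (gface i x) k = if (k.+1 < i)%N then at_ x k
    else if k.+1 == i then at_ x k * at_ x k.+1 else at_ x k.+1.
Proof.
move=> kq; rewrite -[k in LHS]/(val (Ordinal kq)) -at_ord ffunE !at_ord /=.
by rewrite /bump leq0n.
Qed.

Let at_degen q i (x : {ffun 'I_q -> G}) k : (k < q.+1)%N -> (i <= q)%N ->
  at_ (gdegen i x) k = if (k < i)%N then at_ x k
    else if k == i then 1 else at_ x k.-1.
Proof.
move=> kq iq; rewrite -[k in LHS]/(val (Ordinal kq)) -at_ord ffunE.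
case: unliftP => [j|] /(congr1 val); rewrite /= inordK //; last first.
  by move=> ->; rewrite ltnn eqxx.
rewrite at_ord /bump; have [ij|ij] := leqP i j => ->.
  by rewrite add1n ltnNge leqW //= gtn_eqF.
by rewrite add0n ij.
Qed.

Lemma gnerveP :
  simplicial_identities (X := fun q => {ffun 'I_q -> G}) gface gdegen.
Proof.
split=> [n i j x ij|n i j x ij|n j x jn|n j x jn|n i j x ij|n i j x ij];
  apply: at_inj => k kn;
  do ![rewrite at_face; last lia | rewrite at_degen; [|lia|lia]
      | case: ifP => ?; try lia];
  rewrite ?(mulgA, mulg1, mul1g) //; try lia.
all: try by (repeat f_equal; lia).
all: by have -> : k.-1.+1 = k.+1.-1 by lia.
Qed.

End GroupNerve.

Section GroupNerveMap.
Variables (G G' : groupType).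

Definition gmap q (f : G -> G') (x : {ffun 'I_q -> G}) : {ffun 'I_q -> G'} :=
  [ffun j => f (x j)].

Lemma gmap_face (f : {multiplicative G -> G'}) q i (x : {ffun 'I_q.+1 -> G}) :
  gmap f (gface i x) = gface i (gmap f x).
Proof. by apply/ffunP => j; rewrite !ffunE /=; do ![case: ifP => _] => //; rewrite gmulfM. Qed.

Lemma gmap_degen (f : {multiplicative G -> G'}) q i (x : {ffun 'I_q -> G}) :
  gmap f (gdegen i x) = gdegen i (gmap f x).
Proof.
apply/ffunP => j; rewrite !ffunE /=; case: unlift => [k|]; rewrite ?ffunE //.
exact: multiplicative1.
Qed.

End GroupNerveMap.

Section BisimplicialNerve.
Variable S : simplicialGroup.

Definition bner_obj p q : choiceType := {ffun 'I_q -> S p}.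

Lemma bner_hP q : simplicial_identities (X := fun p => bner_obj p q)
  (fun p i => gmap (@sgface S p i)) (fun p i => gmap (@sgdegen S p i)).
Proof.
split=> [n i j x ij|n i j x ij|n j x jn|n j x jn|n i j x ij|n i j x ij];
  apply/ffunP => k; rewrite !ffunE.
- exact: (simp_dd (sgP S)).
- exact: (simp_ds_lt (sgP S)).
- exact: (simp_ds_eq (sgP S)).
- exact: (simp_ds_eqS (sgP S)).
- exact: (simp_ds_gt (sgP S)).
- exact: (simp_ss (sgP S)).
Qed.

Definition bisimplicial_nerve : bisimplicialSet :=
  @BisimplicialSet bner_obj
    (fun p q i => gmap (@sgface S p i)) (fun p q i => gmap (@sgdegen S p i))
    (fun p q i => @gface (S p) q i) (fun p q i => @gdegen (S p) q i)
    bner_hP (fun p => @gnerveP (S p))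
    (fun p q i j x => gmap_face (sgface S p i) j x)
    (fun p q i j x => gmap_degen (sgface S p i) j x)
    (fun p q i j x => gmap_face (sgdegen S p i) j x)
    (fun p q i j x => gmap_degen (sgdegen S p i) j x).

End BisimplicialNerve.

Record rightGModule (G : groupType) := RightGModule {
  rgobj :> zmodType;
  ract : rgobj -> G -> rgobj;
  ractD : forall g, {morph ract^~ g : m m' / (m + m')%R};
  ract1 : forall m, ract m 1 = m;
  ractM : forall m g g', ract m (g * g') = ract (ract m g) g'
}.

Record leftGModule (G : groupType) := LeftGModule {
  lgobj :> zmodType;
  lact : G -> lgobj -> lgobj;
  lactD : forall g, {morph lact g : m m' / (m + m')%R};
  lact1 : forall m, lact 1 m = m;
  lactM : forall m g g', lact (g * g') m = lact g (lact g' m)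
}.

Definition trivial_int (G : groupType) : leftGModule G :=
  @LeftGModule G int (fun _ k => k) (fun _ _ _ => erefl) (fun _ => erefl)
    (fun _ _ _ => erefl).

Local Close Scope group_scope.

Section Tensor.
Variables (G : groupType) (M : rightGModule G) (N : leftGModule G).

Notation gen m n := (<< (m, n) >> : {freeg (M * N)%type / int}).

Inductive tensor_rel : {freeg (M * N)%type / int} -> Prop :=
| TensorAddl m m' n : tensor_rel (gen (m + m') n - gen m n - gen m' n)
| TensorAddr m n n' : tensor_rel (gen m (n + n') - gen m n - gen m n')
| TensorBal m g n : tensor_rel (gen (ract m g) n - gen m (lact g n))
| Tensor0 : tensor_rel 0
| TensorB x y : tensor_rel x -> tensor_rel y -> tensor_rel (x - y).

Definition tensor_pred : {pred {freeg (M * N)%type / int}} :=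
  fun x => `[< tensor_rel x >].

Lemma tensor_pred_zmod_closed : zmod_closed tensor_pred.
Proof.
split=> [|x y]; rewrite !unfold_in; first by apply/asboolP; exact: Tensor0.
by move=> /asboolP hx /asboolP hy; apply/asboolP; exact: TensorB.
Qed.

HB.instance Definition _ := GRing.isZmodClosed.Build
  {freeg (M * N)%type / int} tensor_pred tensor_pred_zmod_closed.

Definition tensor : zmodType := Quotient.quot tensor_pred.

Definition tensor_class (x : {freeg (M * N)%type / int}) : tensor :=
  \pi_(Quotient.quot tensor_pred) x.

Lemma tensor_class_is_zmod_morphism : zmod_morphism tensor_class.
Proof. by move=> x y; rewrite /tensor_class raddfB. Qed.

HB.instance Definition _ := GRing.isZmodMorphism.Build
  {freeg (M * N)%type / int} tensor tensor_class tensor_class_is_zmod_morphism.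

Lemma tensor_class_eq x y : tensor_class x = tensor_class y <-> tensor_rel (x - y).
Proof.
split=> [/eqP|h]; last apply/eqP; rewrite -Quotient.idealrBE unfold_in.
  by move/asboolP.
exact/asboolP.
Qed.

Lemma tensor_gen_eq m m' (n : N) :
  m = m' -> tensor_class << (m, n) >> = tensor_class << (m', n) >>.
Proof. by move->. Qed.

Lemma tensor_class0l n : tensor_class << (0, n) >> = 0.
Proof.
rewrite -(raddf0 tensor_class); apply/tensor_class_eq; rewrite subr0.
have := TensorAddl 0 0 n; rewrite addr0 subrr sub0r => /(TensorB Tensor0).
by rewrite sub0r opprK.
Qed.

Definition tensor_repr (t : tensor) : {freeg (M * N)%type / int} :=
  repr (t : Quotient.quot tensor_pred).

Lemma tensor_reprK : cancel tensor_repr tensor_class.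
Proof. by move=> t; apply: reprK. Qed.

End Tensor.

Record semilinear (G G' : groupType) (f : G -> G')
    (M : rightGModule G) (M' : rightGModule G') := Semilinear {
  slmap :> {additive M -> M'};
  slmap_act : forall m g, slmap (ract m g) = ract (slmap m) (f g)
}.

Section TensorMap.
Variables (G G' : groupType) (f : G -> G').
Variables (M : rightGModule G) (M' : rightGModule G').
Variable phi : semilinear f M M'.

Let ZG := trivial_int G.
Let ZG' := trivial_int G'.

Definition tensor_lift : {additive {freeg (M * ZG)%type / int} ->
                                   {freeg (M' * ZG')%type / int}} :=
  fgpush (fun p : M * ZG => (phi p.1, p.2 : ZG')).

Let tensor_lift_rel (x : {freeg (M * ZG)%type / int}) :
  tensor_rel x -> tensor_rel (tensor_lift x).
Proof.
elim=> [m m' n|m n n'|m g n||{}x y _ hx _ hy].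
- by rewrite !raddfB !fgpushU /= raddfD; exact: (@TensorAddl G' M' ZG').
- by rewrite !raddfB !fgpushU; exact: (@TensorAddr G' M' ZG').
- by rewrite raddfB !fgpushU /= slmap_act; exact: (@TensorBal G' M' ZG').
- by rewrite raddf0; exact: Tensor0.
- by rewrite raddfB; exact: TensorB.
Qed.

(* [phi] tensored with the identity of the trivial module. *)
Definition tensor_map (t : tensor M ZG) : tensor M' ZG' :=
  tensor_class (tensor_lift (tensor_repr t)).

Lemma tensor_map_class x :
  tensor_map (tensor_class x) = tensor_class (tensor_lift x).
Proof.
apply/tensor_class_eq; rewrite -raddfB; apply: tensor_lift_rel.
by apply/tensor_class_eq; rewrite tensor_reprK.
Qed.

Lemma tensor_map_gen m (n : ZG) :
  tensor_map (tensor_class << (m, n) >>) = tensor_class << (phi m, n : ZG') >>.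
Proof. by rewrite tensor_map_class /tensor_lift fgpushU. Qed.

Lemma tensor_map_is_zmod_morphism : zmod_morphism tensor_map.
Proof.
move=> x y; rewrite -[x]tensor_reprK -[y]tensor_reprK -raddfB.
by rewrite !tensor_map_class !raddfB.
Qed.

HB.instance Definition _ := GRing.isZmodMorphism.Build
  (tensor M ZG) (tensor M' ZG') tensor_map tensor_map_is_zmod_morphism.

End TensorMap.

Lemma tensor_eq_additive (G : groupType) (M : rightGModule G)
    (N : leftGModule G) (V : zmodType) (f g : {additive tensor M N -> V}) :
  (forall m n, f (tensor_class << (m, n) >>) = g (tensor_class << (m, n) >>)) ->
  f =1 g.
Proof.
move=> fg t; rewrite -(tensor_reprK t).
apply: (@fg_eq_additive _ _ (f \o @tensor_class G M N) (g \o @tensor_class G M N)).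
by case=> m n /=.
Qed.

Section Bar.
Variable G : groupType.

(* The generator [x] of B_m stands for x_0 (x) ... (x) x_m; the group acts on
   the last factor. *)
Definition bar_gact m (x : {ffun 'I_m.+1 -> G}) (g : G) : {ffun 'I_m.+1 -> G} :=
  [ffun j => if j == ord_max then (x j * g)%g else x j].

Definition bar_act m (b : {freeg {ffun 'I_m.+1 -> G} / int}) (g : G) :=
  fgpush (fun x => bar_gact x g) b.

Lemma bar_actD m g : {morph @bar_act m ^~ g : b b' / b + b'}.
Proof. by move=> b b'; rewrite /bar_act raddfD. Qed.
Lemma bar_act1 m b : @bar_act m b 1%g = b.
Proof.
have E : fgpush (fun x => @bar_gact m x 1%g) =1 idfun.
  apply: fg_eq_additive => x; rewrite fgpushU /=; congr << _ >>.
  by apply/ffunP => j; rewrite ffunE mulg1 if_same.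
exact: E.
Qed.
Lemma bar_actM m b g g' : @bar_act m b (g * g')%g = bar_act (bar_act b g) g'.
Proof.
have E : fgpush (fun x => @bar_gact m x (g * g')%g)
     =1 fgpush (fun x => @bar_gact m x g') \o fgpush (fun x => @bar_gact m x g).
  apply: fg_eq_additive => x; rewrite /= !fgpushU; congr << _ >>.
  by apply/ffunP => j; rewrite !ffunE; case: ifP => // _; rewrite mulgA.
exact: E.
Qed.

Definition bar m : rightGModule G :=
  @RightGModule G {freeg {ffun 'I_m.+1 -> G} / int} (@bar_act m)
    (@bar_actD m) (@bar_act1 m) (@bar_actM m).

(* The faces are those of the nerve of the group on the factors x_0, ..., x_m,
   except that the last one, which would drop x_m, does not occur. *)
Definition bar_diff_map m : {additive bar m.+1 -> bar m} :=
  altsum m.+2 (fun i => fgpush (@gface G m.+1 i)).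

Lemma bar_diff_act m (b : bar m.+1) g :
  bar_diff_map m (ract b g) = ract (bar_diff_map m b) g.
Proof.
rewrite /bar_diff_map /= /altsum /bar_act raddf_sum; apply: eq_bigr => i _.
rewrite raddfMz; congr (_ *~ _).
have E : fgpush (@gface G m.+1 i) \o fgpush (fun x => bar_gact x g)
     =1 fgpush (fun x => bar_gact x g) \o fgpush (@gface G m.+1 i).
  apply: fg_eq_additive => x; rewrite /= !fgpushU; congr << _ >>.
  apply/ffunP => j; rewrite !ffunE -!val_eqE /= /bump leq0n add1n eqSS.
  have /ltn_eqF jm : (j < m.+1)%N by [].
  rewrite jm; have ? := ltn_ord i; have ? := ltn_ord j.
  case: ltngtP => ji; case: eqVneq => jm' //=; rewrite ?mulgA //; lia.
exact: E.
Qed.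

Definition bar_diff m : semilinear id (bar m.+1) (bar m) :=
  @Semilinear G G id (bar m.+1) (bar m) (bar_diff_map m) (@bar_diff_act m).

Lemma bar_diffK m (b : bar m.+2) : bar_diff m (bar_diff m.+1 b) = 0.
Proof.
apply: altsum_altsum_eq0 => i j {}b ij.
have E : fgpush (@gface G m.+1 i) \o fgpush (@gface G m.+2 j.+1)
  =1 fgpush (@gface G m.+1 j) \o fgpush (@gface G m.+2 i).
  apply: fg_eq_additive => x; rewrite /= !fgpushU (simp_dd (gnerveP G)) //.
  lia.
exact: E.
Qed.

End Bar.

Section BarMap.
Variables (G G' : groupType) (f : {multiplicative G -> G'}) (m : nat).

Definition bar_map_fun : {additive bar G m -> bar G' m} := fgpush (gmap f).

Lemma bar_map_act (b : bar G m) g :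
  bar_map_fun (ract b g) = ract (bar_map_fun b) (f g).
Proof.
have E : fgpush (gmap f) \o fgpush (fun x => bar_gact x g)
     =1 fgpush (fun x : {ffun 'I_m.+1 -> G'} => bar_gact x (f g))
        \o fgpush (gmap f).
  apply: fg_eq_additive => x; rewrite /= !fgpushU; congr << _ >>.
  by apply/ffunP => j; rewrite !ffunE; case: ifP => // _; rewrite gmulfM.
exact: E.
Qed.

Definition bar_map : semilinear f (bar G m) (bar G' m) :=
  @Semilinear G G' f (bar G m) (bar G' m) bar_map_fun bar_map_act.

End BarMap.

Lemma bar_map_diff (G G' : groupType) (f : {multiplicative G -> G'}) m
    (b : bar G m.+1) :
  bar_map f m (bar_diff G m b) = bar_diff G' m (bar_map f m.+1 b).
Proof.
rewrite /= /altsum raddf_sum; apply: eq_bigr => i _.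
rewrite raddfMz; congr (_ *~ _).
have E : fgpush (gmap f) \o fgpush (@gface G m.+1 i)
     =1 fgpush (@gface G' m.+1 i) \o fgpush (gmap f).
  by apply: fg_eq_additive => x; rewrite /= !fgpushU gmap_face.
exact: E.
Qed.

Section BarBicomplex.
Variable S : simplicialGroup.

Definition barbic_obj p q : zmodType := tensor (bar (S p) q) (trivial_int (S p)).

Definition barbic_h p q : {additive barbic_obj p.+1 q -> barbic_obj p q} :=
  altsum p.+2 (fun i => tensor_map (bar_map (sgface S p i) q)).

Definition barbic_v p q : {additive barbic_obj p q.+1 -> barbic_obj p q} :=
  tensor_map (bar_diff (S p) q).

Lemma barbic_hK p q (x : barbic_obj p.+2 q) :
  barbic_h p q (barbic_h p.+1 q x) = 0.
Proof.
apply: altsum_altsum_eq0 => i j {}x ij.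
have E : tensor_map (bar_map (sgface S p i) q)
           \o tensor_map (bar_map (sgface S p.+1 j.+1) q)
      =1 tensor_map (bar_map (sgface S p j) q)
           \o tensor_map (bar_map (sgface S p.+1 i) q).
  apply: tensor_eq_additive => m n; rewrite /= !tensor_map_gen.
apply: (@tensor_gen_eq _ (bar (S p) q) (trivial_int (S p))).
  have E : fgpush (gmap (sgface S p i)) \o fgpush (gmap (sgface S p.+1 j.+1))
        =1 fgpush (gmap (q := q.+1) (sgface S p j))
             \o fgpush (gmap (sgface S p.+1 i)).
    apply: fg_eq_additive => y; rewrite /= !fgpushU; congr << _ >>.
    by apply/ffunP => k; rewrite !ffunE (simp_dd (sgP S)).
  exact: E.
exact: E.
Qed.

Lemma barbic_vK p q (x : barbic_obj p q.+2) :
  barbic_v p q (barbic_v p q.+1 x) = 0.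
Proof.
have E : tensor_map (bar_diff (S p) q) \o tensor_map (bar_diff (S p) q.+1)
      =1 \0.
  apply: tensor_eq_additive => m n; rewrite /= !tensor_map_gen.
  by rewrite bar_diffK tensor_class0l.
exact: E.
Qed.

Lemma barbic_hv p q (x : barbic_obj p.+1 q.+1) :
  barbic_h p q (barbic_v p.+1 q x) = barbic_v p q (barbic_h p q.+1 x).
Proof.
rewrite /barbic_h /= /altsum [RHS]raddf_sum; apply: eq_bigr => i _.
rewrite [RHS]raddfMz; congr (_ *~ _).
have E : tensor_map (bar_map (sgface S p i) q)
           \o tensor_map (bar_diff (S p.+1) q)
      =1 tensor_map (bar_diff (S p) q)
           \o tensor_map (bar_map (sgface S p i) q.+1).
  apply: tensor_eq_additive => m n; rewrite /= !tensor_map_gen.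
  apply: (@tensor_gen_eq _ (bar (S p) q) (trivial_int (S p))).
  exact: bar_map_diff.
exact: E.
Qed.

Definition bar_bicomplex : bicomplex :=
  Bicomplex barbic_hK barbic_vK barbic_hv.

End BarBicomplex.

Section CrossedModuleHomology.
Variables (H G : groupType) (X : crossedModule H G).

Definition crossed_homology (n : nat) : zmodType :=
  homology (total (bar_bicomplex (nerve_sgroup X))) n.

(* The simplicial set whose geometric realisation is the classifying space; the
   integral homology of the latter is taken to be that of the chains on it. *)
Definition classifying_sset : simplicialSet :=
  diagonal (bisimplicial_nerve (nerve_sgroup X)).

Definition baues_ellis_homology (n : nat) : zmodType :=
  homology (simplicial_chains classifying_sset) n.

End CrossedModuleHomology.

Definition isomorphic (V W : zmodType) : Prop :=
  exists f : {additive V -> W}, bijective f.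

(* Main.v *)
(* The coinvariants of the bar resolution B_q(Ner_p) are free abelian on Ner_p^q,
   by forgetting the last factor.  So the bar bicomplex is that of the
   bisimplicial abelian group spanned by the bisimplicial nerve, and the theorem
   is the generalised Eilenberg-Zilber theorem, for the Alexander-Whitney map
   diag A -> Tot A.  That map is a homology isomorphism by dimension shifting,
   over all bisimplicial abelian groups A at once: the double decalage
   P_{p,q} = A_{p+1,q+1} maps onto A by the last faces, and both diag P and
   Tot P are acyclic in positive degrees thanks to the last degeneracies, so
   that degree n + 1 for A follows from degree n for P and for the kernel of
   P -> A. *)
From HB Require Import structures.
From mathcomp Require Import boolp freeg.
From mathcomp Require Import all_boot all_algebra.
From mathcomp Require Import zify.
Require Import Defs.

Set Implicit Arguments.
Unset Strict Implicit.
Unset Printing Implicit Defensive.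

Import GRing.Theory.
Local Open Scope ring_scope.
Local Open Scope quotient_scope.

(** * Chain maps and homology *)

Lemma isomorphic_sym (V W : zmodType) : isomorphic V W -> isomorphic W V.
Proof.
case=> f [g fK gK].
have gM : zmod_morphism g.
  by move=> x y; rewrite -{1}[x]gK -{1}[y]gK -raddfB fK.
pose gA : {additive W -> V} :=
  HB.pack g (GRing.isZmodMorphism.Build W V g gM).
by exists gA; exists f.
Qed.

Lemma isomorphic_trans (U V W : zmodType) :
  isomorphic U V -> isomorphic V W -> isomorphic U W.
Proof. by move=> [f f_bij] [g g_bij]; exists (g \o f); apply: bij_comp. Qed.

Section HomologyIso.
Variables (C D : chainComplex) (f : forall n, {additive C n -> D n}).
Hypothesis f_diff : forall n x, f n (ccdiff C n x) = ccdiff D n (f n.+1 x).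

Lemma chain_map_cycle n x :
  x \in @iscycle C n -> f n x \in @iscycle D n.
Proof.
by case: n x => [|n] x //; rewrite !unfold_in -f_diff => /eqP ->; rewrite raddf0.
Qed.

Definition cycle_map n (z : cycles C n) : cycles D n :=
  Cycle (chain_map_cycle (valP z)).

Definition homology_class (E : chainComplex) n (z : cycles E n) :
  homology E n := \pi_(Quotient.quot (@isboundary E n)) z.

Lemma homology_class_eq (E : chainComplex) n (x y : cycles E n) :
  homology_class x = homology_class y <->
  exists w, ccdiff E n w = val x - val y.
Proof.
split=> [/eqP|h]; last apply/eqP; rewrite -Quotient.idealrBE unfold_in.
  by move/asboolP.
exact/asboolP.
Qed.

Definition homology_map n (h : homology C n) : homology D n :=
  homology_class (cycle_map (repr (h : Quotient.quot (@isboundary C n)))).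

(** The map is computed on a chosen representative; two representatives differ by a boundary, which
    [f] sends to a boundary. *)
Lemma homology_map_class n (z : cycles C n) :
  homology_map (homology_class z) = homology_class (cycle_map z).
Proof.
apply/homology_class_eq.
have /homology_class_eq[w wE] :
    homology_class (repr (homology_class z)) = homology_class z by exact: reprK.
by exists (f n.+1 w); rewrite -f_diff wE raddfB.
Qed.

Lemma homology_class_surj (E : chainComplex) n (h : homology E n) :
  exists z : cycles E n, h = homology_class z.
Proof. by exists (repr h); rewrite /homology_class reprK. Qed.

Lemma homology_map_is_zmod_morphism n : zmod_morphism (@homology_map n).
Proof.
move=> h h'; have [x ->] := homology_class_surj h.
have [y ->] := homology_class_surj h'.
have piB (E : chainComplex) (a b : cycles E n) :
  homology_class a - homology_class b = homology_class (a - b).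
  by rewrite /homology_class raddfB.
rewrite piB !homology_map_class piB.
by congr homology_class; apply: val_inj; rewrite /= raddfB.
Qed.

HB.instance Definition _ n := GRing.isZmodMorphism.Build
  (homology C n) (homology D n) (@homology_map n)
  (@homology_map_is_zmod_morphism n).

Lemma homology_iso n :
  (forall x, x \in @iscycle C n -> forall y, ccdiff D n y = f n x ->
     exists z, ccdiff C n z = x) ->
  (forall y, y \in @iscycle D n -> exists2 x, x \in @iscycle C n &
     exists w, ccdiff D n w = y - f n x) ->
  isomorphic (homology C n) (homology D n).
Proof.
move=> f_inj f_surj; exists (@homology_map n).
have surj (y : homology D n) : exists x, @homology_map n x = y.
  have [z ->] := homology_class_surj y.
  have [x cx [w wE]] := f_surj _ (valP z).
  exists (homology_class (Cycle cx)); rewrite homology_map_class.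
  by apply/esym/homology_class_eq; exists w.
have class0 (E : chainComplex) : 0 = homology_class (0 : cycles E n).
  by rewrite /homology_class raddf0.
have inj : injective (@homology_map n).
  apply: raddf_inj => h; have [z ->] := homology_class_surj h.
  rewrite class0 => /(eq_trans (esym (homology_map_class z))).
  case/homology_class_eq=> y; rewrite raddf0 addr0 => /f_inj[|w wE].
    exact: valP.
  by rewrite class0; apply/homology_class_eq; exists w; rewrite raddf0 addr0.
pose g y := projT1 (cid (surj y)).
have gK : cancel g (@homology_map n) by move=> y; rewrite /g; case: cid.
by exists g => // x; apply: inj; rewrite gK.
Qed.

Lemma homology_chain_iso n :
  (forall m, bijective (f m)) -> isomorphic (homology C n) (homology D n).
Proof.
move=> f_bij; have [g fK gK] := f_bij n; have [g' fK' gK'] := f_bij n.+1.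
apply: homology_iso => [x _ y yE|y cy].
  by exists (g' y); apply: (can_inj fK); rewrite f_diff gK'.
exists (g y); last by exists 0; rewrite gK subrr raddf0.
(* In degree 0 every chain is a cycle; above it, that [g y] is a cycle follows from injectivity of
   [f] one degree lower. *)
case: n y cy g fK gK g' fK' gK' => // n y cy g fK gK g' _ _.
have [k hK kK] := f_bij n.
rewrite unfold_in; apply/eqP/(can_inj hK); rewrite f_diff gK raddf0.
by apply/eqP.
Qed.

End HomologyIso.

(** * Bisimplicial abelian groups and the Alexander-Whitney map *)

Record bisimplicialAb := BisimplicialAb {
  baobj :> nat -> nat -> zmodType;
  bahf : forall p q, nat -> {additive baobj p.+1 q -> baobj p q};
  bahs : forall p q, nat -> {additive baobj p q -> baobj p.+1 q};
  bavf : forall p q, nat -> {additive baobj p q.+1 -> baobj p q};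
  bavs : forall p q, nat -> {additive baobj p q -> baobj p q.+1};
  bahP : forall q, simplicial_identities (X := fun p => baobj p q)
    (fun p i => bahf p q i) (fun p i => bahs p q i);
  bavP : forall p, simplicial_identities (X := fun q => baobj p q)
    (fun q i => bavf p q i) (fun q i => bavs p q i);
  ba_ff : forall p q i j (x : baobj p.+1 q.+1),
    bahf p q i (bavf p.+1 q j x) = bavf p q j (bahf p q.+1 i x);
  ba_fs : forall p q i j (x : baobj p.+1 q),
    bahf p q.+1 i (bavs p.+1 q j x) = bavs p q j (bahf p q i x);
  ba_sf : forall p q i j (x : baobj p q.+1),
    bahs p q i (bavf p q j x) = bavf p.+1 q j (bahs p q.+1 i x)
}.

(** * Total and diagonal complexes of a bisimplicial abelian group *)

Section Complexes.
Variable A : bisimplicialAb.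

Definition ba_hdiff p q : {additive A p.+1 q -> A p q} :=
  altsum p.+2 (bahf A p q).
Definition ba_vdiff p q : {additive A p q.+1 -> A p q} :=
  altsum q.+2 (bavf A p q).

Lemma ba_hdiffK p q (x : A p.+2 q) : ba_hdiff p q (ba_hdiff p.+1 q x) = 0.
Proof. by apply: altsum_altsum_eq0 => i j {}x ij; rewrite (simp_dd (bahP A q)). Qed.

Lemma ba_vdiffK p q (x : A p q.+2) : ba_vdiff p q (ba_vdiff p q.+1 x) = 0.
Proof. by apply: altsum_altsum_eq0 => i j {}x ij; rewrite (simp_dd (bavP A p)). Qed.

Lemma ba_hvdiff p q (x : A p.+1 q.+1) :
  ba_hdiff p q (ba_vdiff p.+1 q x) = ba_vdiff p q (ba_hdiff p q.+1 x).
Proof.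
rewrite /= /altsum.
under eq_bigr do rewrite raddf_sum mulrz_suml.
under [RHS]eq_bigr do rewrite raddf_sum mulrz_suml.
rewrite exchange_big /=; apply: eq_bigr => j _; apply: eq_bigr => i _.
by rewrite !raddfMz ba_ff -!mulrzA mulrC.
Qed.

Definition ba_bicomplex : bicomplex := Bicomplex ba_hdiffK ba_vdiffK ba_hvdiff.

Definition ba_diagdiff n : {additive A n.+1 n.+1 -> A n n} :=
  altsum n.+2 (fun i => bahf A n n i \o bavf A n.+1 n i).

Lemma ba_diagdiffK n (x : A n.+2 n.+2) :
  ba_diagdiff n (ba_diagdiff n.+1 x) = 0.
Proof.
apply: altsum_altsum_eq0 => i j {}x ij.
by rewrite /= -!ba_ff (simp_dd (bahP A _)) // (simp_dd (bavP A _)).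
Qed.

Definition ba_diag : chainComplex :=
  @ChainComplex (fun n => A n n) ba_diagdiff ba_diagdiffK.

Lemma diag_boundary_cycle n (x : A n.+1 n.+1) :
  ba_diagdiff n x \in @iscycle ba_diag n.
Proof. by case: n x => // n x; rewrite unfold_in /= ba_diagdiffK. Qed.

(** The total differential is taken on arbitrary families, and the degree is tracked apart by
    [concentrated]. Identities can then be checked bidegree by bidegree without casts along $p + q =
    n$. *)
Definition tdiff : family2 A -> family2 A := @totdiff_fam ba_bicomplex.

Lemma fam_addE (x y : family2 A) p q : (x + y) p q = x p q + y p q.
Proof. by []. Qed.
Lemma fam_oppE (x : family2 A) p q : (- x) p q = - x p q.
Proof. by []. Qed.

Lemma tdiff_is_zmod_morphism : zmod_morphism tdiff.
Proof.
move=> x y; apply: family2P => p q.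
rewrite /tdiff /totdiff_fam !fam_addE !fam_oppE !raddfB mulrzBl.
by rewrite opprD addrACA.
Qed.
HB.instance Definition _ := GRing.isZmodMorphism.Build
  (family2 A) (family2 A) tdiff tdiff_is_zmod_morphism.

Lemma tdiffK x : tdiff (tdiff x) = 0.
Proof.
apply: family2P => p q; rewrite /tdiff /totdiff_fam !raddfD !raddfMz.
rewrite bchK bcvK bchv !mul0rz add0r addr0.
by rewrite exprS mulN1r mulrNz addNr.
Qed.

Definition concentrated n (x : family2 A) := forall p q, (p + q)%N <> n -> x p q = 0.

Lemma concentratedB n x y :
  concentrated n x -> concentrated n y -> concentrated n (x - y).
Proof. by move=> hx hy p q pq; rewrite fam_addE fam_oppE hx // hy // subr0. Qed.

Lemma concentrated_tdiff n x : concentrated n.+1 x -> concentrated n (tdiff x).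
Proof.
move=> hx p q pq; rewrite /tdiff /totdiff_fam !hx ?raddf0 ?mul0rz ?addr0 //; lia.
Qed.

(** A diagonal element is turned into a family so that faces can be iterated as endomaps of one
    fixed type. It sits in bidegree (n, n), hence not yet on the antidiagonal of total degree n. *)
Definition single n (x : A n n) : family2 A := fun p q =>
  match @eqP nat n p, @eqP nat n q with
  | ReflectT np, ReflectT nq => ecast p (A p q) np (ecast q (A n q) nq x)
  | _, _ => 0
  end.

Lemma single_diag n x : @single n x n n = x.
Proof.
rewrite /single; case: (@eqP nat n n) => // e.
by rewrite !eq_axiomK.
Qed.

Lemma single_off n x p q : (n != p) || (n != q) -> @single n x p q = 0.
Proof. by rewrite /single; case: (@eqP nat n p) => // e; case: (@eqP nat n q). Qed.

Lemma single_is_zmod_morphism n : zmod_morphism (@single n).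
Proof.
move=> x y; apply: family2P => p q; rewrite fam_addE fam_oppE.
have [off|] := boolP ((n != p) || (n != q)).
  by rewrite !single_off // subr0.
by rewrite negb_or !negbK => /andP[/eqP <- /eqP <-]; rewrite !single_diag.
Qed.
HB.instance Definition _ n := GRing.isZmodMorphism.Build
  (A n n) (family2 A) (@single n) (@single_is_zmod_morphism n).

(** * Faces of families and the Alexander-Whitney map *)

Definition hface i (x : family2 A) : family2 A := fun p q => bahf A p q i (x p.+1 q).
Definition vface i (x : family2 A) : family2 A := fun p q => bavf A p q i (x p q.+1).
(** The index of the last face varies with the bidegree, so this is no instance of [hface]. *)
Definition hlast (x : family2 A) : family2 A := fun p q => bahf A p q p.+1 (x p.+1 q).
Definition vfirst := vface 0.

Lemma hface_is_zmod_morphism i : zmod_morphism (hface i).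
Proof. by move=> x y; apply: family2P => p q; rewrite /hface raddfB. Qed.
HB.instance Definition _ i := GRing.isZmodMorphism.Build
  (family2 A) (family2 A) (hface i) (hface_is_zmod_morphism i).

Lemma hlast_is_zmod_morphism : zmod_morphism hlast.
Proof. by move=> x y; apply: family2P => p q; rewrite /hlast raddfB. Qed.
HB.instance Definition _ := GRing.isZmodMorphism.Build
  (family2 A) (family2 A) hlast hlast_is_zmod_morphism.

Lemma vface_is_zmod_morphism i : zmod_morphism (vface i).
Proof. by move=> x y; apply: family2P => p q; rewrite /vface raddfB. Qed.
HB.instance Definition _ i := GRing.isZmodMorphism.Build
  (family2 A) (family2 A) (vface i) (vface_is_zmod_morphism i).
HB.instance Definition _ := GRing.isZmodMorphism.Build
  (family2 A) (family2 A) vfirst (vface_is_zmod_morphism 0).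

Lemma iter_zmod_morphism (V : zmodType) (f : {additive V -> V}) k :
  zmod_morphism (iter k f).
Proof. by elim: k => [|k IH] x y //=; rewrite IH raddfB. Qed.

(** The Alexander-Whitney map: front face horizontally, back face vertically. The value in bidegree
    (p, q) only reads [x] at (p + q, p + q), whence [aw (single x)] lies on one antidiagonal. *)
Definition aw (x : family2 A) : family2 A := fun p q =>
  iter q hlast (iter p vfirst x) p q.

Lemma aw_is_zmod_morphism : zmod_morphism aw.
Proof.
move=> x y; apply: family2P => p q.
by rewrite /aw !(iter_zmod_morphism vfirst, iter_zmod_morphism hlast).
Qed.
HB.instance Definition _ := GRing.isZmodMorphism.Build
  (family2 A) (family2 A) aw aw_is_zmod_morphism.

Lemma iter_hlast_low k i x p q : (i <= p)%N ->
  iter k hlast (hface i x) p q = hface i (iter k hlast x) p q.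
Proof.
elim: k p => [|k IH] p ip //=; rewrite {1}/hlast IH; last lia.
by rewrite /hface [RHS](simp_dd (bahP A q)) //; lia.
Qed.

Lemma iter_hlast_high k i x p q : (p < i <= p + k.+1)%N ->
  iter k hlast (hface i x) p q = iter k.+1 hlast x p q.
Proof.
elim: k p => [|k IH] p ip; first by have -> : i = p.+1 by lia.
have [pi|pi] := ltnP p.+1 i.
  by rewrite [LHS]/= {1}/hlast IH //; lia.
have -> : i = p.+1 by lia.
by rewrite /= {1}/hlast iter_hlast_low // /hface -(simp_dd (bahP A q)) //; lia.
Qed.

Lemma iter_vfirst_high k i x p q : (k <= i <= q + k.+1)%N ->
  iter k vfirst (vface i x) p q = vface (i - k) (iter k vfirst x) p q.
Proof.
elim: k q => [|k IH] q iq; first by rewrite subn0.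
rewrite /= {1}/vfirst {1}/vface IH; last lia.
rewrite /vfirst /vface; have -> : (i - k = (i - k.+1).+1)%N by lia.
by rewrite (simp_dd (bavP A p)) //; lia.
Qed.

Lemma iter_vfirst_low k i x p q : (i <= k)%N ->
  iter k vfirst (vface i x) p q = iter k.+1 vfirst x p q.
Proof.
elim: k q => [|k IH] q ik; first by have -> : i = 0%N by lia.
have [ik'|ik'] := leqP i k; first by rewrite [LHS]/= {1}/vfirst {1}/vface IH.
have -> : i = k.+1 by lia.
rewrite [LHS]/= {1}/vfirst {1}/vface iter_vfirst_high; last lia.
by rewrite subSnn [RHS]/= /vfirst /vface (simp_dd (bavP A p)).
Qed.

Lemma hface_vface i j x : hface i (vface j x) = vface j (hface i x).
Proof. by apply: family2P => p q; rewrite /hface /vface ba_ff. Qed.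

Lemma hlast_vface j x : hlast (vface j x) = vface j (hlast x).
Proof. by apply: family2P => p q; rewrite /hlast /vface ba_ff. Qed.

Lemma iter_hlast_vface k j x :
  iter k hlast (vface j x) = vface j (iter k hlast x).
Proof. by elim: k => //= k ->; rewrite hlast_vface. Qed.

Lemma iter_hlast_iter_vfirst k l x :
  iter k hlast (iter l vfirst x) = iter l vfirst (iter k hlast x).
Proof. by elim: l => //= l <-; rewrite iter_hlast_vface. Qed.

Lemma hface_iter_vfirst l j x :
  hface j (iter l vfirst x) = iter l vfirst (hface j x).
Proof. by elim: l => //= l <-; rewrite hface_vface. Qed.

(** The vertical face is absorbed as one more first face, while the horizontal one moves past all
    the last faces. *)
Lemma aw_faces_low p q i x : (i <= p)%N ->
  aw (hface i (vface i x)) p q = bahf A p q i (aw x p.+1 q).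
Proof.
move=> ip; rewrite /aw -hface_iter_vfirst iter_hlast_low // /hface.
congr (bahf A p q i _).
by rewrite !iter_hlast_iter_vfirst iter_hlast_vface iter_vfirst_low.
Qed.

(** Dually, the horizontal face is absorbed as one more last face, and moving the vertical one past
    p first faces lowers its index by p. *)
Lemma aw_faces_high p q i x : (p < i <= p + q.+1)%N ->
  aw (hface i (vface i x)) p q = bavf A p q (i - p) (aw x p q.+1).
Proof.
move=> ip; rewrite /aw -hface_iter_vfirst iter_hlast_high // !iter_hlast_iter_vfirst.
by rewrite iter_hlast_vface iter_vfirst_high //; lia.
Qed.

Lemma aw_faces_meet p q x :
  bahf A p q p.+1 (aw x p.+1 q) = bavf A p q 0 (aw x p q.+1).
Proof.
have E : hlast (iter q hlast (iter p.+1 vfirst x)) =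
         vfirst (iter q.+1 hlast (iter p vfirst x)).
  by rewrite -[RHS]iter_hlast_vface.
exact: (congr1 (fun y : family2 A => y p q) E).
Qed.

Lemma fam_sumE I (r : seq I) (F : I -> family2 A) p q :
  (\sum_(i <- r) F i) p q = \sum_(i <- r) F i p q.
Proof. by elim: r => [|i r IH]; rewrite ?big_nil // !big_cons fam_addE IH. Qed.

Lemma fam_signE (x : family2 A) i p q :
  (x *~ (-1) ^+ i) p q = x p q *~ (-1) ^+ i.
Proof. by rewrite -signr_odd; case: odd; rewrite ?mulrN1z ?mulr1z. Qed.

Lemma aw_tdiff x p q n : (p + q)%N = n ->
  aw (\sum_(i < n.+2) hface i (vface i x) *~ (-1) ^+ i) p q = tdiff (aw x) p q.
Proof.
move=> <-{n}; rewrite raddf_sum fam_sumE.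
under eq_bigr do rewrite raddfMz fam_signE.
rewrite /tdiff /totdiff_fam /= /altsum.
rewrite -(big_mkord xpredT (fun i => aw (hface i (vface i x)) p q *~ (-1) ^+ i)).
(* The diagonal faces 0, ..., p become horizontal ones, and p + 1, ..., p + q + 1 become the
   vertical faces 1, ..., q + 1. *)
rewrite (big_cat_nat (n := p.+1)) /=; [|lia|lia].
(* Two terms of the total differential remain, the last horizontal and the first vertical face. They
   agree by [aw_faces_meet], have signs $(-1)^{p+1}$ and $(-1)^p$, and cancel. *)
rewrite [X in _ = X + _]big_ord_recr [X in _ = _ + X *~ _]big_ord_recl /=.
rewrite aw_faces_meet exprS mulN1r mulrNz mulrzDl expr0 mulr1z addrA subrK.
congr (_ + _).
  rewrite big_mkord; apply: eq_bigr => i _.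
  by rewrite aw_faces_low // -ltnS.
rewrite -{1}[p.+1]add0n big_addn mulrz_suml.
have -> : ((p + q).+2 - p.+1)%N = q.+1 by lia.
rewrite big_mkord; apply: eq_bigr => i _.
rewrite aw_faces_high; last by have := ltn_ord i; lia.
have -> : (i + p.+1 - p)%N = bump 0 i by rewrite /bump /=; lia.
by rewrite -mulrzA -exprD; congr (_ *~ _ ^+ _); rewrite /bump /=; lia.
Qed.

Lemma single_diagdiff n (x : A n.+1 n.+1) :
  single (ba_diagdiff n x) =
  \sum_(i < n.+2) hface i (vface i (single x)) *~ (-1) ^+ i.
Proof.
rewrite /= /altsum raddf_sum; apply: eq_bigr => i _; rewrite raddfMz; congr (_ *~ _).
apply: family2P => p q; rewrite /hface /vface.
have [off|] := boolP ((n != p) || (n != q)).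
  by rewrite [LHS]single_off // single_off ?eqSS // !raddf0.
by rewrite negb_or !negbK => /andP[/eqP <- /eqP <-]; rewrite single_diag [LHS]single_diag.
Qed.

Lemma iter_hlast_at k x p q : x (p + k)%N q = 0 -> iter k hlast x p q = 0.
Proof.
elim: k p => [|k IH] p x0 /=; first by rewrite addn0 in x0.
by rewrite /hlast IH ?raddf0 // addSnnS.
Qed.

Lemma iter_vfirst_at k x p q : x p (q + k)%N = 0 -> iter k vfirst x p q = 0.
Proof.
elim: k q => [|k IH] q x0 /=; first by rewrite addn0 in x0.
by rewrite /vfirst /vface IH ?raddf0 // addSnnS.
Qed.

Lemma aw_single_concentrated n x : concentrated n (aw (@single n x)).
Proof.
move=> p q pq; apply: iter_hlast_at.
by apply: iter_vfirst_at; rewrite single_off //; lia.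
Qed.

Lemma aw_diagdiff n (x : A n.+1 n.+1) :
  aw (single (ba_diagdiff n x)) = tdiff (aw (single x)).
Proof.
apply: family2P => p q; have [pq|/eqP pq] := eqVneq (p + q)%N n.
  by rewrite single_diagdiff; apply: aw_tdiff.
rewrite (@aw_single_concentrated n) //.
by rewrite (@concentrated_tdiff n) //; apply: aw_single_concentrated.
Qed.

End Complexes.

(** * Double decalage *)

Section Decalage.
Variable A : bisimplicialAb.

Lemma dec_hP q : simplicial_identities (X := fun p => A p.+1 q.+1)
  (fun p i => bahf A p.+1 q.+1 i) (fun p i => bahs A p.+1 q.+1 i).
Proof.
have AP := bahP A q.+1.
split=> [n i j x ij|n i j x ij|n j x jn|n j x jn|n i j x ij|n i j x ij].
- by apply: (simp_dd AP); lia.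
- by apply: (simp_ds_lt AP); lia.
- by apply: (simp_ds_eq AP); lia.
- by apply: (simp_ds_eqS AP); lia.
- by apply: (simp_ds_gt AP); lia.
- by apply: (simp_ss AP); lia.
Qed.

Lemma dec_vP p : simplicial_identities (X := fun q => A p.+1 q.+1)
  (fun q i => bavf A p.+1 q.+1 i) (fun q i => bavs A p.+1 q.+1 i).
Proof.
have AP := bavP A p.+1.
split=> [n i j x ij|n i j x ij|n j x jn|n j x jn|n i j x ij|n i j x ij].
- by apply: (simp_dd AP); lia.
- by apply: (simp_ds_lt AP); lia.
- by apply: (simp_ds_eq AP); lia.
- by apply: (simp_ds_eqS AP); lia.
- by apply: (simp_ds_gt AP); lia.
- by apply: (simp_ss AP); lia.
Qed.

(* The last face in each direction is no longer a face of [dec]: both together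
   give the augmentation [dec_aug], and the last degeneracy a contraction. *)
Definition dec : bisimplicialAb := @BisimplicialAb (fun p q => A p.+1 q.+1)
  (fun p q => bahf A p.+1 q.+1) (fun p q => bahs A p.+1 q.+1)
  (fun p q => bavf A p.+1 q.+1) (fun p q => bavs A p.+1 q.+1) dec_hP dec_vP
  (fun p q => @ba_ff A p.+1 q.+1) (fun p q => @ba_fs A p.+1 q.+1)
  (fun p q => @ba_sf A p.+1 q.+1).

Definition dec_aug p q : {additive dec p q -> A p q} :=
  bahf A p q p.+1 \o bavf A p.+1 q q.+1.
(** A section in each bidegree only: it does not commute with the top faces. Its failure to commute
    with the differentials takes values in the kernel of [dec_aug], and this drives the dimension
    shift. *)
Definition dec_sec p q : {additive A p q -> dec p q} :=
  bahs A p q.+1 p \o bavs A p q q.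

Lemma dec_secK p q (x : A p q) : dec_aug p q (dec_sec p q x) = x.
Proof.
rewrite /dec_aug /dec_sec /= -ba_sf (simp_ds_eqS (bahP A q)) //.
by rewrite (simp_ds_eqS (bavP A p)).
Qed.

Lemma dec_aug_hf p q i (x : dec p.+1 q) : (i <= p.+1)%N ->
  dec_aug p q (bahf dec p q i x) = bahf A p q i (dec_aug p.+1 q x).
Proof.
move=> ip; rewrite /dec_aug /= -ba_ff; apply/esym.
by apply: (simp_dd (bahP A q)); lia.
Qed.

Lemma dec_aug_vf p q i (x : dec p q.+1) : (i <= q.+1)%N ->
  dec_aug p q (bavf dec p q i x) = bavf A p q i (dec_aug p q.+1 x).
Proof.
move=> iq; rewrite /dec_aug /= -ba_ff; congr (bahf A p q _ _); apply/esym.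
by apply: (simp_dd (bavP A p.+1)); lia.
Qed.

Lemma dec_aug_hs p q i (x : dec p q) : (i <= p)%N ->
  dec_aug p.+1 q (bahs dec p q i x) = bahs A p q i (dec_aug p q x).
Proof.
move=> ip; rewrite /dec_aug /= -ba_sf.
by apply: (simp_ds_gt (bahP A q)); lia.
Qed.

Lemma dec_aug_vs p q i (x : dec p q) : (i <= q)%N ->
  dec_aug p q.+1 (bavs dec p q i x) = bavs A p q i (dec_aug p q x).
Proof.
move=> iq; rewrite /dec_aug /= -ba_fs; congr (bahf A _ _ _ _).
by apply: (simp_ds_gt (bavP A p.+1)); lia.
Qed.

Lemma dec_aug_diagdiff n (x : dec n.+1 n.+1) :
  dec_aug n n (ba_diagdiff dec n x) = ba_diagdiff A n (dec_aug n.+1 n.+1 x).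
Proof.
rewrite [X in dec_aug _ _ X]/= [RHS]/= /altsum raddf_sum; apply: eq_bigr => i _.
rewrite raddfMz; congr (_ *~ _).
have ile : (i <= n.+1)%N by rewrite -ltnS.
rewrite [LHS]dec_aug_hf // [RHS]/=; congr (bahf A n n i _).
exact: dec_aug_vf.
Qed.

Definition fam_aug (x : family2 dec) : family2 A := fun p q => dec_aug p q (x p q).
Definition fam_sec (x : family2 A) : family2 dec := fun p q => dec_sec p q (x p q).

Lemma fam_aug_is_zmod_morphism : zmod_morphism fam_aug.
Proof. by move=> x y; apply: family2P => p q; rewrite /fam_aug raddfB. Qed.
HB.instance Definition _ := GRing.isZmodMorphism.Build
  (family2 dec) (family2 A) fam_aug fam_aug_is_zmod_morphism.

Lemma fam_secK x : fam_aug (fam_sec x) = x.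
Proof. by apply: family2P => p q; apply: dec_secK. Qed.

Lemma concentrated_sec n x : concentrated n x -> concentrated n (fam_sec x).
Proof. by move=> xn p q pq; rewrite /fam_sec xn // raddf0. Qed.

Lemma concentrated_aug n x : concentrated n x -> concentrated n (fam_aug x).
Proof. by move=> xn p q pq; rewrite /fam_aug xn // raddf0. Qed.

Lemma fam_aug_single n (x : dec n n) :
  fam_aug (single x) = single (dec_aug n n x).
Proof.
apply: family2P => p q; rewrite /fam_aug.
have [off|] := boolP ((n != p) || (n != q)).
  by rewrite !single_off // raddf0.
by rewrite negb_or !negbK => /andP[/eqP <- /eqP <-]; rewrite !single_diag.
Qed.

Lemma fam_aug_tdiff x : fam_aug (tdiff x) = tdiff (fam_aug x).
Proof.
apply: family2P => p q; rewrite /fam_aug /tdiff /totdiff_fam.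
rewrite raddfD raddfMz.
congr (_ + _ *~ _); rewrite [X in dec_aug _ _ X]/= [RHS]/= /altsum raddf_sum;
  apply: eq_bigr => i _; rewrite raddfMz; congr (_ *~ _).
  by rewrite dec_aug_hf // -ltnS.
by rewrite dec_aug_vf // -ltnS.
Qed.

Lemma fam_aug_aw x : fam_aug (aw x) = aw (fam_aug x).
Proof.
have hlastE y : fam_aug (hlast y) = hlast (fam_aug y).
  by apply: family2P => p q; apply: dec_aug_hf.
have vfirstE y : fam_aug (vfirst y) = vfirst (fam_aug y).
  by apply: family2P => p q; apply: dec_aug_vf.
have iterE k f g : (forall y, fam_aug (f y) = g (fam_aug y)) ->
    forall y, fam_aug (iter k f y) = iter k g (fam_aug y).
  by move=> fg y; elim: k => //= k <-.
apply: family2P => p q; rewrite /aw -(iterE _ _ _ vfirstE) -(iterE _ _ _ hlastE).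
by [].
Qed.

(** * Contractions from the extra degeneracies *)

Lemma dec_hdiff_extra p q (x : A p.+1 q.+1) :
  ba_hdiff dec p q (bahs A p.+1 q.+1 p.+1 x) =
  bahs A p q.+1 p (altsum p.+1 (bahf A p q.+1) x) + x *~ (-1) ^+ p.+1.
Proof.
(* The last face undoes the degeneracy and gives the signed [x]. The remaining p + 1 faces form the
   differential of [dec] if p > 0, but just the face 0 if p = 0, hence the bare [altsum] in the
   statement. *)
rewrite /= /altsum big_ord_recr /= (simp_ds_eq (bahP A q.+1)) //; congr (_ + _).
rewrite raddf_sum; apply: eq_bigr => i _; rewrite raddfMz; congr (_ *~ _).
by apply: (simp_ds_lt (bahP A q.+1)); have := ltn_ord i; lia.
Qed.

Lemma dec_vdiff_extra p q (x : A p.+1 q.+1) :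
  ba_vdiff dec p q (bavs A p.+1 q.+1 q.+1 x) =
  bavs A p.+1 q q (altsum q.+1 (bavf A p.+1 q) x) + x *~ (-1) ^+ q.+1.
Proof.
rewrite /= /altsum big_ord_recr /= (simp_ds_eq (bavP A p.+1)) //; congr (_ + _).
rewrite raddf_sum; apply: eq_bigr => i _; rewrite raddfMz; congr (_ *~ _).
by apply: (simp_ds_lt (bavP A p.+1)); have := ltn_ord i; lia.
Qed.

Lemma dec_diagdiff_extra n (x : dec n.+1 n.+1) :
  ba_diagdiff dec n x = 0 ->
  ba_diagdiff dec n.+1 (bahs A n.+2 n.+3 n.+2 (bavs A n.+2 n.+2 n.+2 x)) =
  x *~ (-1) ^+ n.+2.
Proof.
move=> dx0; rewrite /= /altsum big_ord_recr /= -ba_sf.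
rewrite (simp_ds_eq (bahP A n.+2)) // (simp_ds_eq (bavP A n.+2)) //.
rewrite -[RHS]add0r; congr (_ + _).
transitivity (bahs A n.+1 n.+2 n.+1 (bavs A n.+1 n.+1 n.+1 (ba_diagdiff dec n x)));
  last by rewrite dx0 !raddf0.
rewrite /= /altsum !raddf_sum; apply: eq_bigr => i _; rewrite !raddfMz; congr (_ *~ _).
have ? := ltn_ord i.
rewrite -ba_sf /= (simp_ds_lt (bahP A n.+2)) //; last lia.
rewrite (simp_ds_lt (bavP A n.+2)) //; last lia.
by rewrite ba_fs.
Qed.

(** The sign is chosen so that, away from the column p = 0, the horizontal and vertical terms that
    do not reproduce [y] add up to a signed degeneracy of [tdiff y]. *)
Definition hext (y : family2 dec) : family2 dec := fun p q =>
  match p return dec p q with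
  | 0 => 0
  | p'.+1 => bahs A p'.+1 q.+1 p'.+1 (y p' q) *~ (-1) ^+ p'
  end.

Definition vext (y : family2 dec) : family2 dec := fun p q =>
  match p, q return dec p q with
  | 0, q'.+1 => bavs A 1 q'.+1 q'.+1 (y 0 q') *~ (-1) ^+ q'.+1
  | _, _ => 0
  end.

Lemma tdiff_hext y : tdiff y = 0 -> forall p q,
  tdiff (hext y) p.+1 q = - y p.+1 q.
Proof.
move=> dy p q; have /(congr1 (fun z : family2 dec => z p q)) := dy.
rewrite /tdiff /totdiff_fam [bch _]/(ba_hdiff _) [bcv _]/(ba_vdiff _).
rewrite [in (0 : family2 dec) p q]/= => dy0.
rewrite /hext raddfMz dec_hdiff_extra mulrzDl -mulrzA -exprD.
(* The exponent p + 2 comes from the last face, and p + 1 from the sign in [hext]. *)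
have -> : (-1 : int) ^+ (p.+2 + p.+1) = -1.
  by rewrite addSn exprS -signr_odd oddD addbb mulr1.
rewrite addrAC mulrN1z -[RHS]add0r; congr (_ - _).
have vE : ba_vdiff dec p.+1 q (bahs A p.+1 q.+2 p.+1 (y p q.+1)) =
  bahs A p.+1 q.+1 p.+1 (ba_vdiff dec p q (y p q.+1)).
  rewrite /= /altsum raddf_sum; apply: eq_bigr => i _.
  by rewrite raddfMz ba_sf.
rewrite -[X in _ + X *~ _]/(ba_vdiff dec p.+1 q (_ *~ _)) raddfMz vE -mulrzDl -raddfMz -raddfD.
by rewrite [X in bahs _ _ _ _ X]dy0 raddf0 mul0rz.
Qed.

Lemma tdiff_hext0 y q :
  tdiff (hext y) 0 q = bahs A 0 q.+1 0 (bahf A 0 q.+1 0 (y 0 q)) - y 0 q.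
Proof.
rewrite /tdiff /totdiff_fam [bch _]/(ba_hdiff _) [bcv _]/(ba_vdiff _).
rewrite /hext raddf0 mul0rz addr0 raddfMz dec_hdiff_extra.
by rewrite /altsum big_ord1 expr0 expr1 !mulr1z mulrN1z.
Qed.

(** On a family living in the column p = 0 the total differential is the vertical one, which the
    last vertical degeneracy contracts in positive degrees. *)
Lemma tdiff_vext e n : concentrated n.+1 e -> tdiff e = 0 ->
  (forall p q, e p.+1 q = 0) -> tdiff (vext e) = e.
Proof.
move=> en de e0; apply: family2P => -[|p] q; last first.
  rewrite e0 /tdiff /totdiff_fam [vext]lock /= -lock.
  by rewrite !raddf0 mul0rz addr0.
rewrite /tdiff /totdiff_fam [bch _]/(ba_hdiff _) [bcv _]/(ba_vdiff _).
rewrite /vext raddf0 add0r expr0 mulr1z raddfMz dec_vdiff_extra mulrzDl.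
rewrite -mulrzA -exprD -[_ ^+ (_ + _)]signr_odd oddD addbb mulr1z -[RHS]add0r.
(* At q = 0 the surviving term is a degeneracy of a face of [e 0 0], which vanishes because [e] has
   positive degree. *)
congr (_ + _); case: q => [|q]; first by rewrite en ?raddf0 ?mul0rz.
have /(congr1 (fun z : family2 dec => z 0 q)) := de.
rewrite /tdiff /totdiff_fam [bch _]/(ba_hdiff _) [bcv _]/(ba_vdiff _).
rewrite e0 raddf0 add0r expr0 mulr1z => deq.
by rewrite [altsum _ _ _]deq raddf0 mul0rz.
Qed.

(* What is left of the horizontal contraction: the projection of the column
   [p = 0] onto the degenerate copy of [A 0 q.+1]. *)
Definition hrest (y : family2 dec) : family2 dec := fun p q =>
  match p return dec p q with
  | 0 => bahs A 0 q.+1 0 (bahf A 0 q.+1 0 (y 0 q))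
  | _ => 0
  end.

(** Contracting horizontally first replaces the cycle by the homologous cycle [hrest y] in the
    column p = 0, which [vext] then bounds. *)
Lemma dec_tdiff_exact n y : concentrated n.+1 y -> tdiff y = 0 ->
  tdiff (vext (hrest y) - hext y) = y.
Proof.
move=> yn dy; have restE : hrest y = y + tdiff (hext y).
  apply: family2P => -[|p] q; rewrite fam_addE.
    by rewrite tdiff_hext0 addrC subrK.
  by rewrite tdiff_hext // subrr.
rewrite raddfB [X in X - _](@tdiff_vext _ n) ?[X in X - _]restE ?addrK //.
- move=> [|p] q pq //=.
  by rewrite yn // !raddf0.
- by rewrite restE raddfD [X in X + _]dy add0r [LHS]tdiffK.
Qed.

Lemma concentrated_exact n y : concentrated n.+1 y ->
  concentrated n.+2 (vext (hrest y) - hext y).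
Proof.
move=> yn; apply: concentratedB => -[|p] [|q] pq //=;
  rewrite yn ?raddf0 ?mul0rz //; lia.
Qed.

End Decalage.

(** * Dimension shifting *)

(* Sub-bisimplicial groups are predicates on an ambient one: all those met in the
   induction live in iterated decalages of the given group. *)
Record subBisimplicial (A : bisimplicialAb) (K : forall p q, A p q -> Prop) :
    Prop := SubBisimplicial {
  sub0 : forall p q, K p q 0;
  subB : forall p q x y, K p q x -> K p q y -> K p q (x - y);
  sub_hf : forall p q i x, (i <= p.+1)%N -> K p.+1 q x -> K p q (bahf A p q i x);
  sub_hs : forall p q i x, (i <= p)%N -> K p q x -> K p.+1 q (bahs A p q i x);
  sub_vf : forall p q i x, (i <= q.+1)%N -> K p q.+1 x -> K p q (bavf A p q i x);
  sub_vs : forall p q i x, (i <= q)%N -> K p q x -> K p q.+1 (bavs A p q i x)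
}.

Definition fam_in (A : bisimplicialAb) (K : forall p q, A p q -> Prop)
  (x : family2 A) := forall p q, K p q (x p q).

Section Sub.
Variables (A : bisimplicialAb) (K : forall p q, A p q -> Prop).
Hypothesis K_sub : subBisimplicial K.
Arguments K : clear implicits.

Lemma subD p q x y : K p q x -> K p q y -> K p q (x + y).
Proof.
move=> Kx Ky; rewrite -[y]opprK -[- y]sub0r; apply: (subB K_sub) => //.
by apply: (subB K_sub) => //; apply: (sub0 K_sub).
Qed.

Lemma sub_sign p q x i : K p q x -> K p q (x *~ (-1) ^+ i).
Proof.
move=> Kx; rewrite -signr_odd; case: odd; rewrite ?mulr1z ?mulrN1z //.
by rewrite -sub0r; apply: (subB K_sub) => //; apply: (sub0 K_sub).
Qed.

Lemma sub_altsum p q p' q' n (F : nat -> {additive A p q -> A p' q'}) x :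
  (forall i, (i < n)%N -> K p' q' (F i x)) -> K p' q' (altsum n F x).
Proof.
move=> KF; apply: (big_ind (K p' q')) => [|u v|i _]; first exact: (sub0 K_sub).
  exact: subD.
by apply: sub_sign; apply: KF.
Qed.

Lemma sub_diagdiff n x : K n.+1 n.+1 x -> K n n (ba_diagdiff A n x).
Proof.
move=> Kx; apply: sub_altsum => i iln /=.
by apply: (sub_hf K_sub) => //; apply: (sub_vf K_sub).
Qed.

Lemma fam_inB x y : fam_in K x -> fam_in K y -> fam_in K (x - y).
Proof. by move=> Kx Ky p q; apply: (subB K_sub). Qed.

Lemma fam_in_tdiff x : fam_in K x -> fam_in K (tdiff x).
Proof.
move=> Kx p q; apply: subD; last apply: sub_sign.
  by apply: sub_altsum => i ip; apply: (sub_hf K_sub).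
by apply: sub_altsum => i ip; apply: (sub_vf K_sub).
Qed.

Lemma fam_in_single n x : K n n x -> fam_in K (single x).
Proof.
move=> Kx p q; have [off|] := boolP ((n != p) || (n != q)).
  by rewrite single_off //; apply: (sub0 K_sub).
by rewrite negb_or !negbK => /andP[/eqP <- /eqP <-]; rewrite single_diag.
Qed.

Lemma fam_in_aw x : fam_in K x -> fam_in K (aw x).
Proof.
have iterP k f : (forall y, fam_in K y -> fam_in K (f y)) ->
    forall y, fam_in K y -> fam_in K (iter k f y).
  by move=> fK y Ky; elim: k => //= k /fK.
move=> Kx p q; apply: (iterP _ (@hlast A)) => [y Ky p' q'|].
  by apply: (sub_hf K_sub).
apply: (iterP _ (@vfirst A)) => // y Ky p' q'.
by apply: (sub_vf K_sub).
Qed.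

(** With [ker_sub] this gives a short exact sequence in each bidegree, [ker_sub K] into [dec_sub K]
    onto [K] by [dec_aug]; [sub_sec] shows that [dec_sec] splits it. *)
Definition dec_sub p q (x : dec A p q) := K p.+1 q.+1 x.
Definition ker_sub p q (x : dec A p q) := K p.+1 q.+1 x /\ dec_aug A p q x = 0.

Lemma dec_subP : subBisimplicial dec_sub.
Proof.
rewrite /dec_sub; split=> *.
- exact: (sub0 K_sub).
- exact: (subB K_sub).
- by apply: (sub_hf K_sub) => //; lia.
- by apply: (sub_hs K_sub) => //; lia.
- by apply: (sub_vf K_sub) => //; lia.
- by apply: (sub_vs K_sub) => //; lia.
Qed.

Lemma ker_subP : subBisimplicial ker_sub.
Proof.
have D := dec_subP.
split=> [p q|p q x y [Kx x0] [Ky y0]|p q i x ip [Kx x0]|p q i x ip [Kx x0]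
  |p q i x iq [Kx x0]|p q i x iq [Kx x0]]; split.
- exact: (sub0 K_sub).
- by rewrite raddf0.
- exact: (subB K_sub).
- by rewrite raddfB [X in X - _]x0 [X in _ - X]y0 subrr.
- exact: (sub_hf D).
- by rewrite [LHS]dec_aug_hf // x0 raddf0.
- exact: (sub_hs D).
- by rewrite [LHS]dec_aug_hs // x0 raddf0.
- exact: (sub_vf D).
- by rewrite [LHS]dec_aug_vf // x0 raddf0.
- exact: (sub_vs D).
- by rewrite [LHS]dec_aug_vs // x0 raddf0.
Qed.

Lemma sub_aug p q (x : dec A p q) : dec_sub x -> K p q (dec_aug A p q x).
Proof.
by move=> Kx; apply: (sub_hf K_sub) => //; apply: (sub_vf K_sub).
Qed.

Lemma sub_sec p q (x : A p q) : K p q x -> dec_sub (dec_sec A p q x).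
Proof.
by move=> Kx; apply: (sub_hs K_sub) => //; apply: (sub_vs K_sub).
Qed.

Lemma dec_diag_exact n (x : dec A n.+1 n.+1) :
  dec_sub x -> ba_diagdiff (dec A) n x = 0 ->
  exists2 z, dec_sub z & ba_diagdiff (dec A) n.+1 z = x.
Proof.
move=> Kx dx0.
(* The extra degeneracy in both directions, with the sign of the last diagonal face. *)
exists (bahs A n.+2 n.+3 n.+2 (bavs A n.+2 n.+2 n.+2 x) *~ (-1) ^+ n.+2).
  apply: sub_sign; apply: (sub_hs K_sub) => //.
  exact: (sub_vs K_sub).
rewrite raddfMz [X in X *~ _]dec_diagdiff_extra //.
by rewrite -mulrzA -exprD -signr_odd oddD addbb mulr1z.
Qed.

Lemma dec_tot_exact n (y : family2 (dec A)) :
  fam_in dec_sub y -> concentrated n.+1 y -> tdiff y = 0 ->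
  exists w, [/\ fam_in dec_sub w, concentrated n.+2 w & tdiff w = y].
Proof.
move=> Ky yn dy; exists (vext (hrest y) - hext y); split.
- move=> p q; apply: (subB K_sub); last first.
    case: p => [|p]; first exact: (sub0 K_sub).
    by apply: sub_sign; apply: (sub_hs K_sub) => //; apply: Ky.
  case: p => [|p]; last exact: (sub0 K_sub).
  case: q => [|q]; first exact: (sub0 K_sub).
  apply: sub_sign; apply: (sub_vs K_sub) => //.
  apply: (sub_hs K_sub) => //; apply: (sub_hf K_sub) => //; apply: Ky.
- exact: concentrated_exact.
- exact: dec_tdiff_exact yn dy.
Qed.

End Sub.

(** Injectivity of Alexander-Whitney on the degree n homology of the subobject [K], and [aw_surj] is
    surjectivity. Bounding chains are sought inside [K], so no homology group of [K] has to be
    formed. *)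
Definition aw_inj (A : bisimplicialAb) (K : forall p q, A p q -> Prop) n :=
  forall x : A n n, x \in @iscycle (ba_diag A) n -> K n n x ->
  forall y, concentrated n.+1 y -> fam_in K y -> tdiff y = aw (single x) ->
  exists2 z, K n.+1 n.+1 z & ba_diagdiff A n z = x.

Definition aw_surj (A : bisimplicialAb) (K : forall p q, A p q -> Prop) n :=
  forall y, concentrated n y -> fam_in K y -> tdiff y = 0 ->
  exists x : A n n, [/\ x \in @iscycle (ba_diag A) n, K n n x &
    exists w, [/\ concentrated n.+1 w, fam_in K w &
                  tdiff w = y - aw (single x)]].

Section DimensionShift.
Variables (A : bisimplicialAb) (K : forall p q, A p q -> Prop).
Hypothesis K_sub : subBisimplicial K.
Arguments K : clear implicits.
Variable n : nat.
Hypothesis ker_inj : aw_inj (@ker_sub A K) n.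
Hypothesis ker_surj : aw_surj (@ker_sub A K) n.
Hypothesis dec_inj : aw_inj (@dec_sub A K) n.

Lemma aw_inj_shift : aw_inj K n.+1.
Proof.
move=> x; rewrite unfold_in => /eqP dx0 Kx y yn Ky dy.
have decK := dec_subP K_sub.
pose x' := dec_sec A _ _ x; pose y' := fam_sec y.
have Kx' : dec_sub K x' by apply: sub_sec.
have Ky' : fam_in (dec_sub K) y' by move=> p q; apply: sub_sec.
(* The lift [x'] need not be a cycle, nor its image the boundary of [y']; both defects lie over 0,
   and [u] is the second one. *)
pose u := aw (single x') - tdiff y'.
have un : concentrated n.+1 u.
  apply: concentratedB; first exact: aw_single_concentrated.
  by apply: concentrated_tdiff; apply: concentrated_sec.
have Ku : fam_in (ker_sub K) u.
  move=> p q; split.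
    apply: (fam_inB decK); last exact: (fam_in_tdiff decK).
    by apply: (fam_in_aw decK); apply: (fam_in_single decK).
  have : fam_aug u = 0.
    rewrite raddfB [X in X - _]fam_aug_aw [X in _ - X]fam_aug_tdiff.
    by rewrite fam_aug_single dec_secK fam_secK dy subrr.
  exact: (congr1 (fun z : family2 A => z p q)).
have du : tdiff u = aw (single (ba_diagdiff (dec A) n x')).
  by rewrite raddfB [X in _ - X]tdiffK subr0 aw_diagdiff.
have Kdx : ker_sub K (ba_diagdiff (dec A) n x').
  split; first exact: (sub_diagdiff decK).
  by rewrite [LHS]dec_aug_diagdiff dec_secK dx0.
(* The image of the boundary of [x'] bounds [u] in the kernel, so that boundary is already that of
   some [k] in the kernel. Then [x' - k] is a cycle over [x], and the exactness of [dec] bounds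
   it. *)
have [k [Kk k0] dk] := ker_inj (diag_boundary_cycle x') Kdx un Ku du.
have [||z Kz dz] := dec_diag_exact K_sub (x := x' - k).
- exact: (subB decK).
- by rewrite raddfB [X in _ - X]dk subrr.
exists (dec_aug A _ _ z); first exact: sub_aug.
by rewrite -dec_aug_diagdiff dz raddfB [X in _ - X]k0 subr0 [LHS]dec_secK.
Qed.

Lemma aw_surj_shift : aw_surj K n.+1.
Proof.
move=> y yn Ky dy.
have decK := dec_subP K_sub.
pose y' := fam_sec y.
have yn' : concentrated n.+1 y' by apply: concentrated_sec.
have Ky' : fam_in (dec_sub K) y' by move=> p q; apply: sub_sec.
have Ku : fam_in (ker_sub K) (tdiff y').
  move=> p q; split; first exact: (fam_in_tdiff decK).
  have : fam_aug (tdiff y') = 0 by rewrite fam_aug_tdiff fam_secK.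
  exact: (congr1 (fun z : family2 A => z p q)).
(* The boundary of the lift [y'] is a cycle of the kernel in degree n, hence homologous there to the
   image of a diagonal cycle [z]. *)
have [z [cz [Kz z0] [w [wn Kw dw]]]] :=
  ker_surj (concentrated_tdiff yn') Ku (tdiffK y').
have Kw' : fam_in (dec_sub K) w by move=> p q; case: (Kw p q).
have wA : fam_aug w = 0 by apply: family2P => p q; case: (Kw p q).
(* The image of [z] bounds [y' - w] in [dec]. Injectivity for [dec] is used here since n may be 0, a
   degree outside the reach of [dec_diag_exact]. *)
have [|||t Kt dt] := dec_inj cz Kz (y := y' - w).
- exact: concentratedB.
- exact: (fam_inB decK).
- by rewrite raddfB [X in _ - X]dw subKr.
(* A cycle of positive degree in [dec], hence a boundary. Under the augmentation [w] dies and [t]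
   becomes a cycle because [z] lies over 0. *)
pose r := y' - w - aw (single t).
have [|||v [Kv vn dv]] := dec_tot_exact K_sub (n := n) (y := r).
- apply: (fam_inB decK); first exact: (fam_inB decK).
  by apply: (fam_in_aw decK); apply: (fam_in_single decK).
- by apply: concentratedB; [apply: concentratedB|apply: aw_single_concentrated].
- rewrite raddfB raddfB [X in _ - X - _]dw subKr.
  by rewrite -[X in _ - X]aw_diagdiff dt subrr.
exists (dec_aug A _ _ t); split; last exists (fam_aug v).
- by rewrite unfold_in; apply/eqP; rewrite [LHS](esym (dec_aug_diagdiff _)) dt.
- exact: sub_aug.
split; first exact: concentrated_aug.
  by move=> p q; apply: sub_aug.
rewrite -fam_aug_tdiff dv raddfB raddfB [X in _ - X - _]wA subr0.
by rewrite [X in X - _]fam_secK [X in _ - X]fam_aug_aw fam_aug_single.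
Qed.

End DimensionShift.

(** * Degree zero and the induction *)

Lemma aw_inj0 (A : bisimplicialAb) (K : forall p q, A p q -> Prop) :
  subBisimplicial K -> aw_inj K 0.
Proof.
move=> K_sub x _ Kx y _ Ky /(congr1 (fun z : family2 A => z 0%N 0%N)).
rewrite [aw _ _ _]single_diag => <-.
(* Degenerating each component in the other direction moves it to the diagonal, and both diagonal
   faces undo that degeneracy. *)
exists (bavs A 1 0 0 (y 1 0) + bahs A 0 1 0 (y 0 1)).
  apply: (subD K_sub); first exact: (sub_vs K_sub).
  exact: (sub_hs K_sub).
rewrite /tdiff /totdiff_fam /= /altsum !big_ord_recl !big_ord0 /=.
rewrite expr0 expr1 !mulr1z !mulrN1z !addr0 !raddfD.
rewrite (simp_ds_eq (bavP A _)) // (simp_ds_eqS (bavP A _)) //.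
rewrite -!ba_sf (simp_ds_eq (bahP A _)) // (simp_ds_eqS (bahP A _)) //.
by rewrite addrACA.
Qed.

Lemma aw_surj0 (A : bisimplicialAb) (K : forall p q, A p q -> Prop) :
  subBisimplicial K -> aw_surj K 0.
Proof.
move=> K_sub y y0 Ky _; exists (y 0 0); split=> //.
exists 0; split; first by [].
  by move=> p q; apply: (sub0 K_sub).
rewrite raddf0; apply: family2P => p q; rewrite fam_addE fam_oppE.
have [pq|/eqP pq] := eqVneq (p + q)%N 0%N; last first.
  by rewrite y0 // (@aw_single_concentrated _ 0) // subrr.
case: p q pq => [|p] [|q] // _.
by rewrite [X in _ - X]single_diag subrr.
Qed.

(** [A] and [K] are generalised in the induction, as the step passes to two subobjects of
    [dec A]. *)
Lemma aw_quasi_iso n (A : bisimplicialAb) (K : forall p q, A p q -> Prop) :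
  subBisimplicial K -> aw_inj K n /\ aw_surj K n.
Proof.
elim: n A K => [|n IH] A K K_sub; first by split; [apply: aw_inj0|apply: aw_surj0].
have [ki ks] := IH _ _ (ker_subP K_sub); have [di _] := IH _ _ (dec_subP K_sub).
by split; [apply: aw_inj_shift|apply: aw_surj_shift].
Qed.

(** * The generalised Eilenberg-Zilber theorem *)

Section GeneralisedEilenbergZilber.
Variable A : bisimplicialAb.

Definition aw_tot n (x : ba_diag A n) : totobj (ba_bicomplex A) n.
Proof.
exists (aw (single x)); rewrite unfold_in; apply/asboolP.
exact: aw_single_concentrated.
Defined.

Lemma aw_tot_is_zmod_morphism n : zmod_morphism (@aw_tot n).
Proof.
move=> x y; apply: val_inj; rewrite [RHS]raddfB /= (raddfB (single (n := n))).
by rewrite (raddfB (@aw A)).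
Qed.
HB.instance Definition _ n := GRing.isZmodMorphism.Build
  (ba_diag A n) (totobj (ba_bicomplex A) n) (@aw_tot n)
  (@aw_tot_is_zmod_morphism n).

Lemma eilenberg_zilber n :
  isomorphic (homology (ba_diag A) n) (homology (total (ba_bicomplex A)) n).
Proof.
have [|awi aws] := @aw_quasi_iso n A (fun _ _ _ => True); first by split.
have conc m (y : totobj (ba_bicomplex A) m) : concentrated m (val y).
  exact/asboolP/(valP y).
have toP m (y : family2 A) :
    concentrated m y -> y \in antidiag (C := ba_bicomplex A) m.
  by move=> yn; rewrite unfold_in; apply/asboolP.
apply: (@homology_iso (ba_diag A) (total (ba_bicomplex A))
          (fun m => @aw_tot m)) => [m x|x cx y|y cy].
- by apply: val_inj; apply: aw_diagdiff.
- move/(congr1 val) => dy.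
  by have [//|z _ dz] := awi x cx I (val y) (conc _ y) _ dy; exists z.
have [//||x [cx _ [w [wn _ dw]]]] := aws (val y) (conc _ y).
  (* [iscycle] is trivially true in degree 0, but [tdiff] of a family concentrated at (0, 0)
     vanishes, since it only reads entries of positive total degree. *)
  case: n y cy {awi aws} => [|n] y cy.
    apply: family2P => p q; rewrite /tdiff /totdiff_fam.
    by rewrite !conc ?raddf0 ?mul0rz ?addr0 //; lia.
  by move: cy; rewrite unfold_in => /eqP/(congr1 val).
exists x => //; exists (TotObj (toP _ _ wn)).
by apply: val_inj; rewrite [RHS]raddfB.
Qed.

End GeneralisedEilenbergZilber.

(** * Coinvariants of the bar resolution *)

Lemma fgpush_comm (K L L' M : choiceType) (f : K -> L) (g : L -> M)
    (f' : K -> L') (g' : L' -> M) :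
  (forall x, g (f x) = g' (f' x)) ->
  forall D, fgpush g (fgpush f D) = fgpush g' (fgpush f' D).
Proof.
move=> fg D.
have E : fgpush g \o fgpush f =1 fgpush g' \o fgpush f'.
  by apply: fg_eq_additive => x; rewrite /= !fgpushU fg.
exact: E.
Qed.

Lemma fgpush_id (K L : choiceType) (f : K -> L) (g : L -> K) :
  cancel f g -> cancel (fgpush f) (fgpush g).
Proof.
move=> fK D; have E : fgpush g \o fgpush f =1 idfun.
  by apply: fg_eq_additive => x; rewrite /= !fgpushU fK.
exact: E.
Qed.

(** * Free abelian groups on a bisimplicial set *)

Lemma freeg_simplicial (Y : nat -> choiceType)
    (d : forall n, nat -> Y n.+1 -> Y n) (s : forall n, nat -> Y n -> Y n.+1) :
  simplicial_identities d s ->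
  simplicial_identities (X := fun n => {freeg (Y n) / int})
    (fun n i => fgpush (d n i)) (fun n i => fgpush (s n i)).
Proof.
move=> P; split=> [n i j x ij|n i j x ij|n j x jn|n j x jn|n i j x ij|n i j x ij].
- by apply: fgpush_comm => y; apply: (simp_dd P).
- by apply: fgpush_comm => y; apply: (simp_ds_lt P).
- by apply: fgpush_id => y; apply: (simp_ds_eq P).
- by apply: fgpush_id => y; apply: (simp_ds_eqS P).
- by apply: fgpush_comm => y; apply: (simp_ds_gt P).
- by apply: fgpush_comm => y; apply: (simp_ss P).
Qed.

Definition freeg_bisimplicial (Y : bisimplicialSet) : bisimplicialAb :=
  @BisimplicialAb (fun p q => {freeg (Y p q) / int})
    (fun p q i => fgpush (@bshface Y p q i))
    (fun p q i => fgpush (@bshdegen Y p q i))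
    (fun p q i => fgpush (@bsvface Y p q i))
    (fun p q i => fgpush (@bsvdegen Y p q i))
    (fun q => freeg_simplicial (bshP Y q)) (fun p => freeg_simplicial (bsvP Y p))
    (fun p q i j => fgpush_comm (@bs_dd Y p q i j))
    (fun p q i j => fgpush_comm (@bs_ds Y p q i j))
    (fun p q i j => fgpush_comm (@bs_sd Y p q i j)).

Lemma homology_diagonal (Y : bisimplicialSet) n :
  isomorphic (homology (simplicial_chains (diagonal Y)) n)
             (homology (ba_diag (freeg_bisimplicial Y)) n).
Proof.
apply: (@homology_chain_iso (simplicial_chains (diagonal Y))
  (ba_diag (freeg_bisimplicial Y)) (fun m => idfun)) => [m x|m].
  rewrite /= /altsum; apply: eq_bigr => i _; congr (_ *~ _).
  have E : fgpush (@diag_face Y m i) =1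
     fgpush (@bshface Y m m i) \o fgpush (@bsvface Y m.+1 m i).
    by apply: fg_eq_additive => y; rewrite /= !fgpushU.
  exact: E.
by exists idfun.
Qed.

(** * Isomorphic bicomplexes have isomorphic total homology *)

Section TotalIso.
Variables (C D : bicomplex) (f : forall p q, {additive C p q -> D p q}).
Hypothesis f_h : forall p q x, f p q (bch C p q x) = bch D p q (f p.+1 q x).
Hypothesis f_v : forall p q x, f p q (bcv C p q x) = bcv D p q (f p q.+1 x).
Hypothesis f_bij : forall p q, bijective (f p q).

Lemma tot_map_subproof n (x : totobj C n) :
  (fun p q => f p q (val x p q)) \in antidiag (C := D) n.
Proof.
rewrite unfold_in; apply/asboolP => p q pq.
by have /asboolP -> := valP x; rewrite ?raddf0.
Qed.

Definition tot_map n (x : totobj C n) : totobj D n := TotObj (tot_map_subproof x).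

Lemma tot_map_is_zmod_morphism n : zmod_morphism (@tot_map n).
Proof.
move=> x y; apply: val_inj; rewrite [RHS]raddfB; apply: family2P => p q /=.
exact: raddfB.
Qed.
HB.instance Definition _ n := GRing.isZmodMorphism.Build
  (totobj C n) (totobj D n) (@tot_map n) (@tot_map_is_zmod_morphism n).

Lemma homology_total_iso n :
  isomorphic (homology (total C) n) (homology (total D) n).
Proof.
apply: (@homology_chain_iso (total C) (total D) (fun m => @tot_map m)) => [m x|m].
  apply: val_inj; apply: family2P => p q /=; rewrite /totdiff_fam /=.
  by rewrite raddfD raddfMz f_h f_v.
have f_inj p q : injective (f p q) := bij_inj (f_bij p q).
have f_surj p q (y : D p q) : exists x, f p q x = y.
  by have [h _ hK] := f_bij p q; exists (h y).
pose h p q y := projT1 (cid (f_surj p q y)).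
have hK p q y : f p q (h p q y) = y by rewrite /h; case: cid.
have h_anti (y : totobj D m) :
  (fun p q => h p q (val y p q)) \in antidiag (C := C) m.
  rewrite unfold_in; apply/asboolP => p q pq; apply: (f_inj p q).
  by rewrite hK raddf0; have /asboolP -> := valP y.
exists (fun y => TotObj (h_anti y)) => x; apply: val_inj; apply: family2P => p q /=.
  by apply: (f_inj p q); rewrite hK.
exact: hK.
Qed.

End TotalIso.

(** * Coinvariants as free abelian groups on truncated tuples *)

Section BarCoinvariants.
Variable G : groupType.
Local Notation ZG := (trivial_int G).

Lemma tensor_class_addl m (b b' : bar G m) (n : ZG) :
  tensor_class << (b + b', n) >> = tensor_class << (b, n) >> + tensor_class << (b', n) >>
   :> tensor (bar G m) ZG.
Proof.
rewrite -raddfD; apply/tensor_class_eq; rewrite opprD addrA.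
exact: TensorAddl.
Qed.

Lemma tensor_class_addr m (b : bar G m) (n n' : ZG) :
  tensor_class << (b, n + n') >> = tensor_class << (b, n) >> + tensor_class << (b, n') >>
   :> tensor (bar G m) ZG.
Proof.
rewrite -raddfD; apply/tensor_class_eq; rewrite opprD addrA.
exact: TensorAddr.
Qed.

(* Forgetting the last factor, on which the group acts. *)
Definition bar_trunc m (x : {ffun 'I_m.+1 -> G}) : {ffun 'I_m -> G} :=
  [ffun j => x (widen_ord (leqnSn m) j)].

Definition bar_extend m (x : {ffun 'I_m -> G}) : {ffun 'I_m.+1 -> G} :=
  [ffun j : 'I_m.+1 => if insub (val j) is Some k then x k else 1%g : G].

Lemma bar_extendK m : cancel (@bar_extend m) (@bar_trunc m).
Proof. by move=> x; apply/ffunP => j; rewrite !ffunE /= valK. Qed.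

(** Each orbit of tuples has a representative with last factor 1, and the last factor of [x] is the
    translation leading to [x]. *)
Lemma bar_truncK m (x : {ffun 'I_m.+1 -> G}) :
  bar_gact (bar_extend (bar_trunc x)) (x ord_max) = x.
Proof.
apply/ffunP => j; rewrite !ffunE /=; case: insubP => [k jm kj|jm].
  rewrite ifN; last by apply/eqP => e; move: jm; rewrite e /= ltnn.
  by rewrite ffunE; congr (x _); apply: val_inj; rewrite /= kj.
have -> : j = ord_max by apply: val_inj => /=; have := ltn_ord j; lia.
by rewrite eqxx mul1g.
Qed.

(** For i = m + 1 the bar face multiplies the last two factors; after truncation it drops the last
    entry, which is exactly the last face of the nerve. *)
Lemma bar_trunc_face m i (x : {ffun 'I_m.+2 -> G}) :
  bar_trunc (gface i x) = gface i (bar_trunc x).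
Proof.
apply/ffunP => j; rewrite !ffunE /=.
have -> : lift ord0 (widen_ord (leqnSn m) j) =
          widen_ord (leqnSn m.+1) (lift ord0 j) by apply: val_inj.
by [].
Qed.

Definition coinv_fun m (p : bar G m * ZG) : {freeg {ffun 'I_m -> G} / int} :=
  fgpush (@bar_trunc m) p.1 *~ p.2.

Definition coinv_lift m :
    {additive {freeg (bar G m * ZG)%type / int} -> {freeg {ffun 'I_m -> G} / int}} :=
  fgext (@coinv_fun m).

Lemma coinv_liftU m p : coinv_lift m << p >> = coinv_fun p.
Proof. exact: fgextU. Qed.

Lemma coinv_rel m (x : {freeg (bar G m * ZG)%type / int}) :
  tensor_rel x -> coinv_lift m x = 0.
Proof.
elim=> [b b' n|b n n'|b g n||{}x y _ hx _ hy].
- by rewrite !raddfB !coinv_liftU /coinv_fun /= raddfD mulrzDl -addrA -opprD subrr.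
- by rewrite !raddfB !coinv_liftU /coinv_fun /= mulrzDr -addrA -opprD subrr.
- rewrite raddfB !coinv_liftU /coinv_fun /=; apply/eqP; rewrite subr_eq0; apply/eqP.
  congr (_ *~ _).
  have E : fgpush (@bar_trunc m) \o fgpush (fun x => @bar_gact G m x g)
    =1 fgpush (@bar_trunc m).
    apply: fg_eq_additive => y; rewrite /= !fgpushU; congr << _ >>.
    (* The action changes only the entry at [ord_max], which truncation forgets. *)
    apply/ffunP => j; rewrite !ffunE ifN //.
    by apply/eqP => /(congr1 val) /=; have := ltn_ord j; lia.
  exact: E.
- by rewrite raddf0.
- by rewrite raddfB hx hy subr0.
Qed.

Definition coinv m (t : tensor (bar G m) ZG) : {freeg {ffun 'I_m -> G} / int} :=
  coinv_lift m (tensor_repr t).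

Lemma coinv_class m x : @coinv m (tensor_class x) = coinv_lift m x.
Proof.
apply/eqP; rewrite -subr_eq0 -raddfB; apply/eqP/coinv_rel.
by apply/tensor_class_eq; rewrite tensor_reprK.
Qed.

Lemma coinv_gen m (b : bar G m) (n : ZG) :
  coinv (tensor_class << (b, n) >>) = fgpush (@bar_trunc m) b *~ n.
Proof. by rewrite coinv_class coinv_liftU. Qed.

Lemma coinv_is_zmod_morphism m : zmod_morphism (@coinv m).
Proof.
move=> x y; rewrite -[x]tensor_reprK -[y]tensor_reprK -raddfB.
by rewrite !coinv_class raddfB.
Qed.
HB.instance Definition _ m := GRing.isZmodMorphism.Build
  (tensor (bar G m) ZG) {freeg {ffun 'I_m -> G} / int} (@coinv m)
  (@coinv_is_zmod_morphism m).

Definition coinv_inv m : {additive {freeg {ffun 'I_m -> G} / int} -> tensor (bar G m) ZG} :=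
  fgext (fun x => tensor_class << (<< bar_extend x >> : bar G m, 1 : ZG) >>).

Lemma coinv_invK m : cancel (@coinv_inv m) (@coinv m).
Proof.
move=> D; have E : @coinv m \o @coinv_inv m =1 idfun.
  apply: fg_eq_additive => x; rewrite /= /coinv_inv fgextU coinv_gen fgpushU.
  by rewrite bar_extendK mulr1z.
exact: E.
Qed.

Section Class.
Variable m : nat.

(** Packaging the class as additive in each argument separately lets [coinvK] reduce to an integer
    multiple of a single tuple. *)
Definition class_left (b : bar G m) : tensor (bar G m) ZG :=
  tensor_class << (b, 1 : ZG) >>.
Lemma class_left_is_zmod_morphism : zmod_morphism class_left.
Proof.
by move=> x y; apply/eqP; rewrite eq_sym subr_eq -tensor_class_addl subrK.
Qed.
HB.instance Definition _ := GRing.isZmodMorphism.Build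
  (bar G m) (tensor (bar G m) ZG) class_left class_left_is_zmod_morphism.

Definition class_right (b : bar G m) (n : int) : tensor (bar G m) ZG :=
  tensor_class << (b, n : ZG) >>.
Lemma class_right_is_zmod_morphism b : zmod_morphism (class_right b).
Proof.
move=> x y; apply/eqP; rewrite eq_sym subr_eq -tensor_class_addr.
apply/eqP; congr (tensor_class << (_, _) >>).
exact/esym/(@subrK int).
Qed.
HB.instance Definition _ b := GRing.isZmodMorphism.Build
  int (tensor (bar G m) ZG) (class_right b) (class_right_is_zmod_morphism b).

End Class.

Lemma coinvK m : cancel (@coinv m) (@coinv_inv m).
Proof.
move=> t; have E : @coinv_inv m \o @coinv m =1 idfun.
  apply: tensor_eq_additive => b n; rewrite /= coinv_gen raddfMz.
  transitivity (class_left b *~ n).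
    congr (_ *~ n).
    have F : @coinv_inv m \o fgpush (@bar_trunc m) =1 @class_left m.
      apply: fg_eq_additive => x; rewrite /= fgpushU /coinv_inv fgextU.
      rewrite /class_left -[in RHS](bar_truncK x).
      (* The balancing relation carries the last factor of [x] across the tensor sign, where it acts
         trivially. *)
      have := TensorBal (<< bar_extend (bar_trunc x) >> : bar G m)
        (x ord_max) (1 : ZG).
      by move/(proj2 (tensor_class_eq _ _)); rewrite /= /bar_act fgpushU => ->.
    exact: F.
  rewrite -[tensor_class _]/(class_right b n) -[in RHS](intz n).
  by rewrite raddfMz.
exact: E.
Qed.

Lemma coinv_bij m : bijective (@coinv m).
Proof. by exists (@coinv_inv m); [apply: coinvK|apply: coinv_invK]. Qed.

End BarCoinvariants.

(** * Comparison of the two bicomplexes *)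

Lemma coinv_bar_map (G G' : groupType) (f : {multiplicative G -> G'}) q t :
  coinv (tensor_map (bar_map f q) t) = fgpush (gmap f) (coinv t).
Proof.
have E : @coinv G' q \o tensor_map (bar_map f q) =1 fgpush (gmap f) \o @coinv G q.
  apply: tensor_eq_additive => b n; rewrite /= tensor_map_gen !coinv_gen raddfMz.
  congr (_ *~ n); apply: fgpush_comm => x.
  by apply/ffunP => j; rewrite !ffunE.
exact: E.
Qed.

Lemma coinv_bar_diff (G : groupType) q t :
  coinv (tensor_map (bar_diff G q) t) =
  altsum q.+2 (fun i => fgpush (@gface G q i)) (coinv t).
Proof.
have E : @coinv G q \o tensor_map (bar_diff G q) =1
   altsum q.+2 (fun i => fgpush (@gface G q i)) \o @coinv G q.+1.
  apply: tensor_eq_additive => b n; rewrite [LHS]/= [RHS]/= tensor_map_gen !coinv_gen.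
  rewrite raddfMz; congr (_ *~ n); rewrite /= /altsum raddf_sum.
  apply: eq_bigr => i _; rewrite raddfMz; congr (_ *~ _).
  by apply: fgpush_comm => x; apply: bar_trunc_face.
exact: E.
Qed.

Lemma homology_bar_bicomplex (S : simplicialGroup) n :
  isomorphic (homology (total (bar_bicomplex S)) n)
    (homology (total (ba_bicomplex (freeg_bisimplicial (bisimplicial_nerve S)))) n).
Proof.
apply: (@homology_total_iso (bar_bicomplex S)
  (ba_bicomplex (freeg_bisimplicial (bisimplicial_nerve S)))
  (fun p q => @coinv (S p) q)) => [p q x|p q x|p q].
- rewrite /= /barbic_h /altsum raddf_sum; apply: eq_bigr => i _.
  by rewrite raddfMz; congr (_ *~ _); apply: coinv_bar_map.
- exact: coinv_bar_diff.
- exact: coinv_bij.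
Qed.

Theorem proposition3p3 (H G : groupType) (X : crossedModule H G) (n : nat) :
  isomorphic (crossed_homology X n) (baues_ellis_homology X n).
Proof.
apply: isomorphic_trans (homology_bar_bicomplex _ _) _.
(* Alexander-Whitney runs from the diagonal to the total complex, so the goal is reversed first. *)
apply: isomorphic_sym; apply: isomorphic_trans (homology_diagonal _ _) _.
exact: eilenberg_zilber.
Qed.
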